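(* Let $\{p_n\}_{n\in\mathbb{N}}$ be an increasing sequence in $(0,1]$, let $\{\omega_n\}_{n\in\mathbb{N}}$ be a family of weights on $\mathbb{Z}^2$ with $\omega_n\ge\omega_{n+1}$ for all $n$, and let $\mathcal{X}=\bigcup_{n\in\mathbb{N}}\ell^{p_n}_{\omega_n}(\mathbb{Z}^2,\mathcal{A})$ (an algebra of Type-II). Suppose that, for each $n\in\mathbb{N}$, either $\omega_n$ satisfies the property $\ast_{\omega_n}$ or at least one of $\rho_{1,\omega_n},\rho_{2,\omega_n},\mu_{1,\omega_n},\mu_{2,\omega_n}$ is not $1$. Let $f\in\mathcal{X}$ be such that $\widehat f(z)$ is left invertible (respectively, right invertible, invertible) in $\mathcal{A}$ for all $z\in\mathbb{T}^2$. Assume further that if $f\in\ell^{p_j}_{\omega_j}(\mathbb{Z}^2,\mathcal{A})$ for some $j\in\mathbb{N}$ such that $\omega_j$ is not admissible and $\omega_{j+1}$ is admissible, then the sequence $\{p_n\}_{n>j}$ is strictly increasing. Then there exists a family of weights $\{\nu_n\}_{n\in\mathbb{N}}$ on $\mathbb{Z}^2$ such that (1) $\nu_n\le\omega_n$ for all $n\in\mathbb{N}$; (2) $\nu_{n+1}\le\nu_n$ for all $n\in\mathbb{N}$; and (3) a left inverse (respectively, right inverse, inverse) of $f$ is in $\bigcup_{n\in\mathbb{N}}\ell^{p_n}_{\nu_n}(\mathbb{Z}^2,\mathcal{A})$, which is an algebra of Type-II.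
   Context: $\mathbb{N}$ is the set of positive integers and $\mathbb{T}$ the unit circle in $\mathbb{C}$. $\mathcal{A}$ is a complex unital Banach algebra, not necessarily commutative, with norm $\|\cdot\|$ and unit $1_{\mathcal A}$. A weight on $\mathbb{Z}^2$ is a map $\omega:\mathbb{Z}^2\to[1,\infty)$ with $\omega(x+y)\le\omega(x)\omega(y)$; inequalities between weights are pointwise. For a weight $\omega$ on $\mathbb{Z}^2$ put $$\rho_{1,\omega}=\sqrt{\sup_{(m_1,m_2)\in\mathbb{N}\times\mathbb{Z}}\omega(-m_1,m_2)^{-1/m_1}},\quad \rho_{2,\omega}=\sqrt{\inf_{(m_1,m_2)\in\mathbb{N}\times\mathbb{Z}}\omega(m_1,m_2)^{1/m_1}},$$ $$\mu_{1,\omega}=\sqrt{\sup_{(m_1,m_2)\in\mathbb{Z}\times\mathbb{N}}\omega(m_1,-m_2)^{-1/m_2}},\quad \mu_{2,\omega}=\sqrt{\inf_{(m_1,m_2)\in\mathbb{Z}\times\mathbb{N}}\omega(m_1,m_2)^{1/m_2}}.$$ A weight $\omega$ on $\mathbb{Z}^2$ is called admissible if $\rho_{1,\omega}=\rho_{2,\omega}=\mu_{1,\omega}=\mu_{2,\omega}=1$. The weight $\omega$ satisfies property $\ast_\omega$ if one of the following holds: (a) $\rho_{1,\omega}=\rho_{2,\omega}=\mu_{1,\omega}=\mu_{2,\omega}=1$, and either $\omega(m_1,-m_2)=\omega(m_1,m_2)$ for all $(m_1,m_2)\in\mathbb{Z}^2$ or $\omega(-m_1,m_2)=\omega(m_1,m_2)$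 for all $(m_1,m_2)\in\mathbb{Z}^2$; (b) $\sup\{\omega(m_1,m_2)^{1/m_1}\omega(m_1,-m_2)^{1/m_1}:m_1<0,m_2\in\mathbb{Z}\}=\inf\{\omega(m_1,m_2)^{1/m_1}\omega(m_1,-m_2)^{1/m_1}:m_1\in\mathbb{N},m_2\in\mathbb{Z}\}$ and $\sup\{\omega(m_1,m_2)^{1/m_2}\omega(-m_1,m_2)^{1/m_2}:m_2<0,m_1\in\mathbb{Z}\}=\inf\{\omega(m_1,m_2)^{1/m_2}\omega(-m_1,m_2)^{1/m_2}:m_2\in\mathbb{N},m_1\in\mathbb{Z}\}$. For $0<p\le1$, $\ell^p_\omega(\mathbb{Z}^2,\mathcal{A})=\{f:\mathbb{Z}^2\to\mathcal{A}:\sum_n\|f(n)\|^p\omega(n)^p<\infty\}$, an algebra under convolution $(f\star g)(n)=\sum_m f(n-m)g(m)$ with unit $\delta_0$ ($\delta_0(\mathbf 0)=1_{\mathcal A}$, zero elsewhere), contained in $\ell^1(\mathbb{Z}^2,\mathcal{A})$ (the case $p=1$, $\omega\equiv1$). For $f\in\ell^1(\mathbb{Z}^2,\mathcal{A})$, $\widehat f(z)=\sum_{n\in\mathbb{Z}^2}f(n)z^n$, $z\in\mathbb{T}^2$, where $z^n=z_1^{n_1}z_2^{n_2}$. Inverses of $f$ are with respect to convolution. Type-II algebra: $\bigcup_n\ell^{p_n}_{\omega_n}(\mathbb{Z}^2,\mathcal{A})$ with $\{p_n\}$ an increasing (not necessarily strictly) sequence in $(0,1]$ and weights $\omega_n\ge\omega_{n+1}$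 for all $n$. *)

(* Defs.v *)
From HB Require Import structures.
From mathcomp Require Import all_boot all_order all_algebra.
From mathcomp Require Import complex.
From mathcomp Require Import all_classical all_reals all_analysis.
From mathcomp Require showcase.summability.

Set Implicit Arguments.
Unset Strict Implicit.
Unset Printing Implicit Defensive.

Import Order.TTheory GRing.Theory Num.Theory.
Import numFieldNormedType.Exports.

Local Open Scope classical_set_scope.
Local Open Scope ring_scope.
Local Open Scope complex_scope.

(* A unital, not necessarily commutative Banach algebra over K.  It cannot be an
   HB structure: a join of rings and normed modules would conflict with
   [Num.NumDomain].  Hence a record over the underlying Banach space, whose
   carrier then receives the algebra structure.  No normalisation `|1| = 1. *)
Record banachAlgType (K : numFieldType) := BanachAlgebra {
  banach_space : completeNormedModType K;
  banach_mul : banach_space -> banach_space -> banach_space;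
  banach_one : banach_space;
  banach_mulA : associative banach_mul;
  banach_mul1 : left_id banach_one banach_mul;
  banach_mulr1 : right_id banach_one banach_mul;
  banach_mulDl : left_distributive banach_mul +%R;
  banach_mulDr : right_distributive banach_mul +%R;
  banach_one_neq0 : banach_one != 0;
  banach_scaleAl : forall (k : K) x y,
    k *: banach_mul x y = banach_mul (k *: x) y;
  banach_scaleAr : forall (k : K) x y,
    k *: banach_mul x y = banach_mul x (k *: y);
  banach_normM : forall x y, `|banach_mul x y| <= `|x| * `|y|
}.

Definition banach_sort (K : numFieldType) (A : banachAlgType K) : Type :=
  banach_space A.
Coercion banach_sort : banachAlgType >-> Sortclass.

Section BanachAlgebraInstances.
Context (K : numFieldType) (A : banachAlgType K).

HB.instance Definition _ :=
  CompleteNormedModule.copy (banach_sort A) (banach_space A).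

HB.instance Definition _ := GRing.Zmodule_isNzRing.Build (banach_sort A)
  (@banach_mulA K A) (@banach_mul1 K A) (@banach_mulr1 K A)
  (@banach_mulDl K A) (@banach_mulDr K A) (banach_one_neq0 A).

HB.instance Definition _ :=
  GRing.Lmodule_isLalgebra.Build K (banach_sort A) (@banach_scaleAl K A).

HB.instance Definition _ :=
  GRing.Lalgebra_isAlgebra.Build K (banach_sort A) (@banach_scaleAr K A).

End BanachAlgebraInstances.

Definition Z2 : Type := (int * int)%type.

Section Weights.
Context {R : realType}.
Implicit Types w : Z2 -> R.

Definition is_weight w :=
  (forall x, 1 <= w x) /\ (forall x y, w (x + y) <= w x * w y).

Definition posnat : set nat := [set m | (0 < m)%N].

Definition rho1 w : R := Num.sqrt
  (sup [set w (- m1%:Z, m2) `^ (- m1%:R^-1) | m1 in posnat & m2 in [set: int]]).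

Definition rho2 w : R := Num.sqrt
  (inf [set w (m1%:Z, m2) `^ (m1%:R^-1) | m1 in posnat & m2 in [set: int]]).

Definition mu1 w : R := Num.sqrt
  (sup [set w (m1, - m2%:Z) `^ (- m2%:R^-1) | m1 in [set: int] & m2 in posnat]).

Definition mu2 w : R := Num.sqrt
  (inf [set w (m1, m2%:Z) `^ (m2%:R^-1) | m1 in [set: int] & m2 in posnat]).

Definition admissible w := [/\ rho1 w = 1, rho2 w = 1, mu1 w = 1 & mu2 w = 1].

Definition star_a w :=
  admissible w /\
  ((forall m1 m2 : int, w (m1, - m2) = w (m1, m2)) \/
   (forall m1 m2 : int, w (- m1, m2) = w (m1, m2))).

Definition star_b w :=
  sup [set w (m1, m2) `^ (m1%:~R^-1) * w (m1, - m2) `^ (m1%:~R^-1)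
      | m1 in [set m : int | m < 0] & m2 in [set: int]]
  = inf [set w (m1%:Z, m2) `^ (m1%:R^-1) * w (m1%:Z, - m2) `^ (m1%:R^-1)
      | m1 in posnat & m2 in [set: int]]
  /\
  sup [set w (m1, m2) `^ (m2%:~R^-1) * w (- m1, m2) `^ (m2%:~R^-1)
      | m1 in [set: int] & m2 in [set m : int | m < 0]]
  = inf [set w (m1, m2%:Z) `^ (m2%:R^-1) * w (- m1, m2%:Z) `^ (m2%:R^-1)
      | m1 in [set: int] & m2 in posnat].

Definition property_star w := star_a w \/ star_b w.

End Weights.

Section Algebras.
Context {R : realType} {A : banachAlgType R[i]}.
Implicit Types (f g : Z2 -> A) (w : Z2 -> R).

(* The norm of a normed module over R[i] is valued in R[i]; it is a nonnegative
   real there, and this is that real number. *)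
Definition rnorm (a : A) : R := complex.Re `|a|.

Definition ellp (p : R) w : set (Z2 -> A) :=
  [set f | (\esum_(n in [set: Z2]) (rnorm (f n) `^ p * w n `^ p)%:E < +oo)%E].

(* [summability.sum] is the unordered sum: the limit of the net of finite
   partial sums. *)
Definition convol f g : Z2 -> A := fun n =>
  summability.sum (fun m : Z2 => f (n - m) * g m).

Definition delta0 : Z2 -> A := fun n => if n == 0 then 1 else 0.

Definition torus2 : set (R[i] * R[i]) := [set z | `|z.1| = 1 /\ `|z.2| = 1].

Definition hat f (z : R[i] * R[i]) : A :=
  summability.sum (fun n : Z2 => (z.1 ^ n.1 * z.2 ^ n.2) *: f n).

Definition left_invertible (a : A) := exists b, b * a = 1.
Definition right_invertible (a : A) := exists b, a * b = 1.
Definition invertible (a : A) := exists b, b * a = 1 /\ a * b = 1.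

Definition is_left_inverse g f := convol g f = delta0.
Definition is_right_inverse g f := convol f g = delta0.
Definition is_inverse g f := is_left_inverse g f /\ is_right_inverse g f.

(* The positive integers indexing the sequences are shifted to start at 0. *)
Definition typeII_data (p : nat -> R) (w : nat -> Z2 -> R) :=
  [/\ forall n, 0 < p n <= 1,
      forall n, p n <= p n.+1,
      forall n, is_weight (w n) &
      forall n x, w n.+1 x <= w n x].

Definition ellp_union (p : nat -> R) (w : nat -> Z2 -> R) : set (Z2 -> A) :=
  \bigcup_n ellp (p n) (w n).

Definition is_typeII (X : set (Z2 -> A)) :=
  exists (p : nat -> R) (w : nat -> Z2 -> R),
    typeII_data p w /\ X = ellp_union p w.

End Algebras.

(* Main.v *)
From HB Require Import structures.
Require Import Defs.
From mathcomp Require Import all_boot all_order all_algebra.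
From mathcomp Require Import finmap complex.
From mathcomp Require Import all_classical all_reals all_analysis.
From mathcomp Require Import zify ring lra.
From mathcomp Require showcase.summability.

(* All the weights nu_n can be taken equal to 1: since the w_n are at least 1,
   f lies in the unweighted l^p for some p = p_j, and the theorem reduces to a
   Wiener lemma for l^p(Z^2, A), 0 < p <= 1, with one-sided inverses.

   For p = 1, put B = l^1(Z^2, A) and J = B f.  For a central invertible z with
   powers bounded by 1 and a left ideal J, if 1 lies in J + B (1 - w z) for all
   w on the unit circle, then 1 lies in J.  Indeed, one can write
   1 = c(w) (1 - w z) modulo J with c Lipschitz in w, on both sides of the circle.
   Averaging c(v) over the n-th roots v of t^n gives an inverse modulo J of
   1 - t^n z^n, which is close to 1 if t < 1 and close to 0 if t > 1, while the
   two averages differ little.  This eliminates the two coordinates of Z^2 one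
   after the other, starting from the invertibility of the value of f at a point
   of the torus.

   For p < 1, multiply f by a finitely supported approximation of its l^1 inverse
   to get 1 - h with |h|_1 < 1 and h in l^p.  The Neumann series of h is dominated
   by that of the scalar sequence |h|, whose convolution powers commute.

   Right inverses follow by passing to the opposite algebra. *)

Set Implicit Arguments.
Unset Strict Implicit.
Unset Printing Implicit Defensive.

Import Order.TTheory GRing.Theory Num.Theory.
Import numFieldNormedType.Exports.
Local Open Scope classical_set_scope.
Local Open Scope ring_scope.
Local Open Scope complex_scope.

(** * Elimination of a unitary central element *)

Section ComplexModulus.
Context {R : realType}.
Implicit Types c d : R[i].

(** The norm of [R[i]] takes its values in [R[i]]; this is the same number in [R], where real
    arithmetic and the order tactics apply. *)
Definition cabs c : R := complex.Re `|c|.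

Lemma cabsE c : `|c| = (cabs c)%:C.
Proof. by rewrite /cabs RRe_real ?normr_real. Qed.

Lemma cabs_ge0 c : 0 <= cabs c.
Proof. by rewrite -ler0c -cabsE normr_ge0. Qed.

Lemma cabsM c d : cabs (c * d) = cabs c * cabs d.
Proof.
by apply: (@complexI R); rewrite rmorphM -!cabsE normrM.
Qed.

Lemma cabsR (a : R) : cabs a%:C = `|a|.
Proof.
by rewrite /cabs normc_def /= expr0n /= addr0 sqrtr_sqr.
Qed.

Lemma cabs1 : cabs 1 = 1.
Proof. by rewrite -[1%R]/(1%:C) cabsR normr1. Qed.

Lemma cabsN c : cabs (- c) = cabs c.
Proof. by rewrite /cabs normrN. Qed.

Lemma cabs_le_ReIm c : cabs c <= `|complex.Re c| + `|complex.Im c|.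
Proof.
rewrite /cabs normc_def /= -(@ler_pXn2r _ 2) ?nnegrE ?sqrtr_ge0 ?addr_ge0//.
rewrite sqr_sqrtr ?addr_ge0 ?sqr_ge0// sqrrD !real_normK ?num_real//.
by rewrite -addrA [X in _ <= _ + X]addrC addrA lerDl mulrn_wge0 ?mulr_ge0.
Qed.

Lemma cabs_sqrtc c : cabs c = 1 -> exists2 d, cabs d = 1 & d ^+ 2 = c.
Proof.
move=> c1; exists (sqrtc c); last exact: sqr_sqrtc.
apply/eqP; rewrite -(@eqrXn2 _ 2) ?cabs_ge0// expr1n expr2 -cabsM -expr2.
by rewrite sqr_sqrtc c1.
Qed.

(* Compactness of the unit circle, through its two half-circle charts. *)
Lemma circle_uniform_bound (P : R -> R[i] -> Prop) :
  (forall a b c, a <= b -> P a c -> P b c) ->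
  (forall c, cabs c = 1 -> exists K e : R, 0 < e /\
     forall d, cabs d = 1 -> cabs (d - c) <= e -> P K d) ->
  exists K, forall c, cabs c = 1 -> P K c.
Proof.
move=> Pmono Ploc.
(* For [s = 1] and [s = -1] these are the upper and lower half-circles over the segment
   [[-1, 1]]. *)
pose arc (s x : R) : R[i] := x +i* (s * Num.sqrt (1 - x ^+ 2)).
have arc1 s x : x \in `[-1, 1] -> s ^+ 2 = 1 -> cabs (arc s x) = 1.
  rewrite in_itv /= => /andP[x0 x1] s1; have x2 : 0 <= 1 - x ^+ 2 by nra.
  by rewrite /cabs normc_def /= exprMn s1 mul1r sqr_sqrtr// addrC subrK sqrtr1.
have half s : s ^+ 2 = 1 ->
    exists K, forall x, x \in `[-1, 1] -> P K (arc s x).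
  (* Compactness as the near-covering property, with the filter at [+oo] for the bound: if near each
     point every large [K] works, then every large [K] works on the whole segment. Monotonicity of
     [P] in [K] provides the local premise. *)
  move=> s1; have /compact_near_coveringP/near_covering_withinP cpt :=
    @segment_compact R (-1) 1.
  have := cpt _ +oo%R (fun K x => P K (arc s x)) _.
  have H : forall x : R, `[-1, 1]%classic x -> \forall x' \near x & K \near +oo%R,
      `[-1, 1]%classic x' -> P K (arc s x').
    move=> x xI; have [K0 [e [e0 He]]] := Ploc _ (arc1 s x xI s1).
    exists ([set y | cabs (arc s y - arc s x) <= e], [set K | K0 < K]) => /=; last first.
      by move=> [y K] /= [Hy /ltW HK] yI; apply: (Pmono _ _ _ HK); apply: He => //; exact: arc1.
    split; last by apply: nbhs_pinfty_gt; exact: num_real.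
    have e2 : 0 < e / 2 by rewrite divr_gt0.
    have sq : {for x, continuous (fun y : R => s * Num.sqrt (1 - y ^+ 2))}.
      apply: cvgMl_tmp; apply: (@continuous_comp _ _ _ (fun y : R => 1 - y ^+ 2) Num.sqrt);
        last exact: sqrt_continuous.
      by apply: cvgB; [exact: cvg_cst|apply: exprn_continuous].
    have /cvgrPdist_le /(_ _ e2) sq' := sq.
    have /cvgrPdist_le /(_ _ e2) id' := @cvg_id _ (nbhs x).
    apply: filterS2 id' sq' => y Hid Hsq; apply: (le_trans (cabs_le_ReIm _)) => /=.
    by rewrite [e]splitr lerD// distrC.
  move=> /(_ _ H) HK; have [K HK'] : exists K, `[-1, 1]%classic `<=` (fun x => P K (arc s x)).
    exact: (@filter_ex _ +oo%R _ _ HK).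
  by exists K => x xI; exact: HK'.
have [K1 HK1] := half 1 (expr1n _ _).
have [K2 HK2] := half (-1) (etrans (sqrrN 1) (expr1n _ _)).
exists (Num.max K1 K2) => -[x y] c1.
have xy : x ^+ 2 + y ^+ 2 = 1.
  move: c1; rewrite /cabs normc_def /= => c1.
  by rewrite -[LHS]sqr_sqrtr ?c1 ?expr1n// addr_ge0 ?sqr_ge0.
have y2 : 1 - x ^+ 2 = y ^+ 2 by rewrite -xy; ring.
have xI : x \in `[-1, 1] by rewrite in_itv /=; apply/andP; split; nra.
have [y0|y0] := leP 0 y.
  have := HK1 x xI; rewrite /arc y2 sqrtr_sqr ger0_norm// mul1r.
  by apply: Pmono; rewrite le_max lexx.
have := HK2 x xI; rewrite /arc y2 sqrtr_sqr ltr0_norm// mulN1r opprK.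
by apply: Pmono; rewrite le_max lexx orbT.
Qed.

End ComplexModulus.

Section UnitaryElimination.
Context {R : realType} (B : algType R[i]) (N : B -> R).
Hypothesis ND : forall x y, N (x + y) <= N x + N y.
Hypothesis NZ : forall c x, N (c *: x) = cabs c * N x.
Hypothesis NM : forall x y, N (x * y) <= N x * N y.
(** The completeness of [B] is abstracted into this one-sided invertibility. A left inverse suffices
    because all congruences are taken modulo a left ideal. *)
Hypothesis neumann : forall e, N e < 1 -> exists v, v * (1 - e) = 1.
Context (z z' : B).
Hypothesis zz' : z * z' = 1.
Hypothesis zC : forall x, z * x = x * z.
Hypothesis Nz : forall x, N (z * x) <= N x.
Hypothesis Nz' : forall x, N (z' * x) <= N x.
Context (J : B -> Prop).
Hypothesis JD : forall x y, J x -> J y -> J (x + y).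
Hypothesis JM : forall a x, J x -> J (a * x).

Let N0 : N 0 = 0.
Proof. by rewrite -(scale0r (0 : B)) NZ /cabs normr0 /= mul0r. Qed.

Let NN x : N (- x) = N x.
Proof. by rewrite -scaleN1r NZ cabsN cabs1 mul1r. Qed.

Let N_ge0 x : 0 <= N x.
Proof. by have := ND x (- x); rewrite subrr N0 NN -mulr2n pmulrn_lge0. Qed.

Let JZ c x : J x -> J (c *: x).
Proof. by move=> Jx; rewrite -[x]mul1r scalerAl; exact: JM. Qed.

Let neumann_bound e : N e <= 1 / 2 ->
  exists2 v, v * (1 - e) = 1 & N (v - 1) <= 2 * N e.
Proof.
move=> e2; have [|v v1] := neumann (e := e); first lra.
(* Working with [v - 1] rather than [v] keeps [N 1], which is not normalised, out of the bound. *)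
exists v => //; have Ev : v - 1 = (v - 1) * e + e.
  by rewrite mulrBl mul1r subrK -[in LHS]v1 mulrBr mulr1 opprB addrCA subrr addr0.
have H : N (v - 1) <= N (v - 1) * N e + N e.
  by rewrite [in leLHS]Ev (le_trans (ND _ _))// lerD2r.
have := N_ge0 (v - 1); have := N_ge0 e; nra.
Qed.

(** Inversion of [1 - w *: z] modulo [J], expressed without forming the quotient. *)
Let resolvent w c := J (1 - c * (1 - w *: z)).

(** Modulo [J], [c * (1 - w' *: z)] equals [1 - e] with [e = (w' - w) *: (c * z)]. Multiplying on
    the left by the inverse [v] of [1 - e] stays within the left ideal and corrects [c] into
    [v * c]. *)
Let resolvent_perturb w w' c : resolvent w c -> cabs (w' - w) * N c <= 1 / 2 ->
  exists2 c', resolvent w' c' & N (c' - c) <= 2 * cabs (w' - w) * N c ^+ 2.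
Proof.
move=> wc small; pose e := (w' - w) *: (c * z).
have Ne : N e <= cabs (w' - w) * N c.
  by rewrite NZ ler_wpM2l ?cabs_ge0// -zC.
have [v v1 Nv] := neumann_bound (le_trans Ne small).
exists (v * c).
  rewrite /resolvent.
  have -> : 1 - v * c * (1 - w' *: z) = v * (1 - c * (1 - w *: z)).
    rewrite -[X in X - _ = _]v1 -mulrA -mulrBr; congr (v * _).
    rewrite /e !mulrBr !mulr1 -!scalerAr scalerBl !opprB.
    by rewrite -!addrA; congr (_ + (_ + _)); rewrite addrA addNr add0r.
  exact: JM.
have -> : v * c - c = (v - 1) * c by rewrite mulrBl mul1r.
apply: (le_trans (NM _ _)).
apply: (le_trans (ler_wpM2r (N_ge0 c) (le_trans Nv (ler_wpM2l _ Ne)))) => //.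
by rewrite expr2 !mulrA.
Qed.

Hypothesis local : forall w, cabs w = 1 -> exists c, resolvent w c.

Let resolvent_bound : exists2 K, 0 <= K &
  forall w, cabs w = 1 -> exists2 c, resolvent w c & N c <= K.
Proof.
have [] := @circle_uniform_bound R
  (fun K w => exists2 c, resolvent w c & N c <= K).
- by move=> a b w ab [c wc Nc]; exists c => //; exact: le_trans ab.
- move=> w w1; have [c wc] := local w1.
  (* On this radius the perturbation is admissible and moves [c] by at most 1, whence the local
     bound [N c + 1]. *)
  exists (N c + 1), (1 / (2 * (N c + 1) ^+ 2)).
  have Nc1 : 0 < N c + 1 by have := N_ge0 c; lra.
  split=> [|w' w'1 ww']; first by rewrite divr_gt0 ?mulr_gt0 ?exprn_gt0.
  have ww'2 : cabs (w' - w) * (N c + 1) ^+ 2 <= 1 / 2.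
    move: ww'; rewrite ler_pdivlMr ?mulr_gt0 ?exprn_gt0//; lra.
  have := cabs_ge0 (w' - w); have := N_ge0 c => c0 ww0.
  have [|c' wc' cc'] := resolvent_perturb (w' := w') wc; first by nra.
  exists c' => //; have -> : c' = c + (c' - c) by rewrite addrC subrK.
  by apply: (le_trans (ND _ _)); rewrite lerD2l (le_trans cc')//; nra.
- move=> K HK; exists K => //.
  by have [c _ Nc] := HK 1 cabs1; exact: le_trans Nc.
Qed.

(* The partial fraction identity for 1/(1 - w z^2n), with w = v^2, in terms of
   1/(1 - v z^n) and 1/(1 + v z^n), averages resolvents on both sides of the
   circle simultaneously. *)
Let resolvent_double (zn : B) v C1 C2 : (forall x, zn * x = x * zn) ->
  J (1 - C1 * (1 - v *: zn)) -> J (1 - C2 * (1 - (- v) *: zn)) ->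
  J (1 - (2^-1 *: (C1 + C2)) * (1 - (v ^+ 2) *: (zn * zn))).
Proof.
move=> znC J1 J2; set x := v *: zn in J1 *.
rewrite scaleNr opprK in J2.
have -> : (v ^+ 2) *: (zn * zn) = x * x.
  by rewrite /x -scalerAl -scalerAr scalerA expr2.
have xC y : x * y = y * x by rewrite /x -scalerAl znC scalerAr.
have E1 : (1 - x * x) = (1 - x) * (1 + x).
  by rewrite mulrDr mulr1 mulrBl mul1r addrA subrK.
have E2 : (1 - x * x) = (1 + x) * (1 - x).
  by rewrite mulrBr mulr1 mulrDl mul1r opprD addrA addrK.
have -> : 1 - (2^-1 *: (C1 + C2)) * (1 - x * x) =
    2^-1 *: ((1 + x) * (1 - C1 * (1 - x)) + (1 - x) * (1 - C2 * (1 + x))).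
  have C (D : B) : D * (1 + x) = (1 + x) * D by rewrite mulrDr mulrDl mulr1 mul1r xC.
  have C' (D : B) : D * (1 - x) = (1 - x) * D by rewrite mulrBr mulrBl mulr1 mul1r xC.
  have F1 : C1 * (1 - x * x) = (1 + x) * (C1 * (1 - x)) by rewrite E1 [LHS]mulrA C.
  have F2 : C2 * (1 - x * x) = (1 - x) * (C2 * (1 + x)) by rewrite E2 [LHS]mulrA C'.
  rewrite -scalerAl mulrDl F1 F2 (mulrBr (1 + x) 1) (mulrBr (1 - x) 1) !mulr1.
  rewrite (addrACA (1 + x))  (addrACA 1 x) subrr addr0 -opprD scalerBr.
  congr (_ - _).
  by rewrite -mulr2n -(scaler_nat 2 (1 : B)) scalerA mulVf ?scale1r// pnatr_eq0.
by apply: JZ; apply: JD; exact: JM.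
Qed.

Let znC n x : z ^+ n * x = x * z ^+ n.
Proof. by apply/esym/commrX => //; rewrite /GRing.comm zC. Qed.

Let Nzn n x : N (z ^+ n * x) <= N x.
Proof.
elim: n => [|n IH]; first by rewrite mul1r.
by rewrite exprS -mulrA (le_trans (Nz _)).
Qed.

Let z'n n : z' ^+ n * z ^+ n = 1.
Proof.
elim: n => [|n IH]; first by rewrite mulr1.
by rewrite exprSr exprS -mulrA [z' * _]mulrA -zC zz' mul1r.
Qed.

Let Nz'n n x : N (z' ^+ n * x) <= N x.
Proof.
elim: n => [|n IH]; first by rewrite mul1r.
by rewrite exprS -mulrA (le_trans (Nz' _)).
Qed.

(** Induction by squaring: for [v ^+ 2 = w], the inverses at [v] and [- v] average to one at [w] for
    the doubled power of [z]. The averages at the radii [t] and [t^-1] run over the same roots, so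
    their distance stays at most 1/4 while the radii are repeatedly squared. *)
Let resolvent_pow (t : R) : 0 < t ->
  (forall w, cabs w = 1 -> exists C1 C2,
    [/\ resolvent (t%:C * w) C1, resolvent (t^-1%:C * w) C2 & N (C1 - C2) <= 1 / 4]) ->
  forall m w, cabs w = 1 -> exists C1 C2,
    [/\ J (1 - C1 * (1 - ((t ^+ (2 ^ m))%:C * w) *: z ^+ (2 ^ m))),
        J (1 - C2 * (1 - ((t ^- (2 ^ m))%:C * w) *: z ^+ (2 ^ m)))
      & N (C1 - C2) <= 1 / 4].
Proof.
move=> t0 base; elim=> [|m IH] w w1.
  by have [C1 [C2 H]] := base w w1; exists C1, C2; rewrite expn0 !expr1.
have [v v1 v2] := cabs_sqrtc w1.
have [C1 [C2 [H1 H2 H12]]] := IH v v1.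
have [D1 [D2 [G1 G2 G12]]] := IH (- v) (etrans (cabsN v) v1).
exists (2^-1 *: (C1 + D1)), (2^-1 *: (C2 + D2)).
rewrite !mulrN in G1 G2.
have := resolvent_double (@znC (2 ^ m)) H1 G1.
have := resolvent_double (@znC (2 ^ m)) H2 G2.
rewrite !exprMn v2 -!rmorphXn /= -exprD addnn -mul2n -expnS -exprVn -!exprM.
rewrite -mulnC -expnS exprVn => K2 K1; split=> //.
rewrite -scalerBr NZ opprD addrACA.
have -> : cabs 2^-1 = 2^-1 :> R.
  by rewrite -[2^-1]/((2%:R)^-1) -(rmorph_nat (real_complex R)) -fmorphV cabsR ger0_norm// invr_ge0.
have := ND (C1 - C2) (D1 - D2); lra.
Qed.

Lemma unitary_elimination : J 1.
Proof.
have [K K0 HK] := resolvent_bound.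
(* With [t = 1 - d] and [t^-1 <= 1 + 2 * d], the two perturbations of [c] have size at most 1/12 and
   1/6, which add up to 1/4. *)
pose d : R := 1 / (24 * (K + 1) ^+ 2).
have K1 : 0 < 24 * (K + 1) ^+ 2 by rewrite mulr_gt0 ?exprn_gt0//; lra.
have dK : d * (24 * (K + 1) ^+ 2) = 1 by rewrite /d divfK ?gt_eqF.
have d0 : 0 < d by rewrite divr_gt0.
have d1 : d <= 1 / 24 by nra.
pose t := 1 - d; have t0 : 0 < t by rewrite /t; lra.
have tV : t^-1 - 1 <= 2 * d.
  have q0 : 0 < t^-1 by rewrite invr_gt0.
  have qd : t^-1 * (1 - d) = 1 by rewrite mulVf ?gt_eqF.
  have q2 : t^-1 <= 2 by nra.
  by nra.
have tV1 : 1 <= t^-1 by rewrite invr_ge1 ?gt_eqF ?unitfE ?gt_eqF// /t; lra.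
have base w : cabs w = 1 -> exists C1 C2,
    [/\ resolvent (t%:C * w) C1, resolvent (t^-1%:C * w) C2 & N (C1 - C2) <= 1 / 4].
  move=> w1; have [c wc Nc] := HK w w1; have := N_ge0 c => c0.
  have dist s : cabs (s%:C * w - w) = `|s - 1|.
    by rewrite -[X in _ - X]mul1r -mulrBl cabsM w1 mulr1 -[1%R in LHS]/(1%:C) -rmorphB cabsR.
  have Dt : cabs (t%:C * w - w) = d by rewrite dist /t addrAC subrr sub0r normrN gtr0_norm.
  have Dt' : 0 <= cabs (t^-1%:C * w - w) <= 2 * d.
    by rewrite dist normr_ge0 ger0_norm ?subr_ge0.
  move: Dt' => /andP[Dt0 Dt'].
  have [|C1 wC1 NC1] := resolvent_perturb (w' := t%:C * w) wc; first by rewrite Dt; nra.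
  have [|C2 wC2 NC2] := resolvent_perturb (w' := t^-1%:C * w) wc; first by nra.
  exists C1, C2; split=> //; rewrite -[C1](subrK c) -addrA (le_trans (ND _ _))//.
  rewrite -[c - C2]opprB NN; rewrite Dt in NC1.
  have cK : N c ^+ 2 <= (K + 1) ^+ 2 by nra.
  have : 0 <= N c ^+ 2 by rewrite sqr_ge0.
  nra.
have N1 := N_ge0 1.
(* Since [N (z ^+ n)] and [N (z' ^+ n)] are at most [N 1], this choice makes both [s] and [s'] below
   have size at most 1/8. *)
have [m Hm] : exists m, t ^+ (2 ^ m) * (N 1) <= 1 / 8.
  have /cvgrPdist_le /(_ (1 / (8 * (N 1 + 1)))) : (fun n => t ^+ n) @ \oo --> (0 : R).
    by apply: cvg_expr; rewrite gtr0_norm// /t; lra.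
  case; first by rewrite divr_gt0 ?mulr_gt0//; lra.
  move=> n _ /(_ (2 ^ n)%N (ltnW (@ltn_expl 2 n isT))) /=.
  rewrite sub0r normrN gtr0_norm ?exprn_gt0// => H; exists n.
  have : 0 <= t ^+ (2 ^ n) by rewrite exprn_ge0// ltW.
  move: H; rewrite ler_pdivlMr ?mulr_gt0//; last lra.
  nra.
have [C1 [C2 []]] := resolvent_pow t0 base m cabs1.
rewrite !mulr1; set n := (2 ^ m)%N in Hm *; move=> H1 H2 H12.
pose s : B := (t ^+ n)%:C *: z ^+ n.
pose s' : B := (t ^+ n)%:C *: z' ^+ n.
have Nt x : cabs (t ^+ n)%:C * N x = t ^+ n * N x.
  by rewrite cabsR gtr0_norm// exprn_gt0.
have Ns : N s <= 1 / 8.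
  rewrite NZ Nt (le_trans _ Hm)// ler_wpM2l ?exprn_ge0 ?(ltW t0)//.
  by rewrite -[z ^+ n]mulr1.
have Ns' : N s' <= 1 / 8.
  rewrite NZ Nt (le_trans _ Hm)// ler_wpM2l ?exprn_ge0 ?(ltW t0)//.
  by rewrite -[z' ^+ n]mulr1.
have [|v v1 Nv] := neumann_bound (e := s); first lra.
have [|v' v'1 Nv'] := neumann_bound (e := s'); first lra.
have sC x : s * x = x * s by rewrite /s -scalerAl znC scalerAr.
(* Outside the circle, [1 - u] is inverted through [s'], the small inverse of [u]: from
   [s' * (1 - u) = - (1 - s')] one gets the inverse [- v' * s' = 1 - v'], which is close to 0. *)
have ss' : s' * ((t ^- n)%:C *: z ^+ n) = 1.
  rewrite /s' -scalerAl -scalerAr scalerA -rmorphM z'n mulfV ?expf_neq0 ?gt_eqF//.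
  by rewrite scale1r.
set u := _ *: z ^+ n in H2 ss'.
have uC x : u * x = x * u by rewrite /u -scalerAl znC scalerAr.
have JC1 : J (v - C1).
  suff -> : v - C1 = v * (1 - C1 * (1 - s)) by exact: JM.
  have C1s : C1 * (1 - s) = (1 - s) * C1 by rewrite mulrBr mulrBl mulr1 mul1r sC.
  by rewrite C1s mulrBr mulr1 mulrA v1 mul1r.
have JC2 : J (v' - 1 + C2).
  suff -> : v' - 1 + C2 = v' * (s' * (1 - C2 * (1 - u))) by apply: JM; exact: JM.
  have C2u : C2 * (1 - u) = (1 - u) * C2 by rewrite mulrBr mulrBl mulr1 mul1r uC.
  have E : v' * (s' * (1 - u)) = - 1.
    by rewrite mulrBr mulr1 ss' -opprB mulrN v'1.
  rewrite C2u !mulrBr mulr1 !mulrA -[v' * s' * _]mulrA E mulN1r opprK.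
  congr (_ + _).
  by rewrite -[v' in LHS]mulr1 -[X in _ - X]v'1 mulrBr opprB addrCA subrr addr0.
(* Modulo [J], [C1] is [v], close to 1, and [C2] is [1 - v'], close to 0, yet they differ by at most
   1/4. Hence [1 + e] lies in [J], with [e] of size at most 1/4 + 1/4 + 1/4. *)
pose e := (C2 - C1) + (v - 1) + (v' - 1).
have Je : J (1 - (- e)).
  suff -> : 1 - (- e) = (v - C1) + (v' - 1 + C2) by exact: JD.
  rewrite opprK /e addrA [1 + (_ + _)]addrC -[_ + (v - 1) + 1]addrA subrK.
  by rewrite -[C2 - C1 + v]addrA [- C1 + v]addrC -[LHS]addrA addrC -[LHS]addrA.
have [|q q1] := neumann (e := - e).
  rewrite NN; have := ND (C2 - C1 + (v - 1)) (v' - 1); have := ND (C2 - C1) (v - 1).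
  rewrite -/e; rewrite -[C2 - C1]opprB NN in H12 *; lra.
by rewrite -q1; exact: JM.
Qed.

End UnitaryElimination.

(** * Unordered sums of extended reals *)

Section UnorderedSums.
Context {R : realType}.
Local Open Scope ereal_scope.
Implicit Types (T U : choiceType).

Lemma esum_swap T U (a : T -> U -> \bar R) : (forall i j, 0 <= a i j) ->
  \esum_(i in setT) \esum_(j in setT) a i j =
  \esum_(j in setT) \esum_(i in setT) a i j.
Proof.
move=> a0; rewrite !esum_esum//.
rewrite (@reindex_esum _ _ _ ([set: U] `*`` (fun=> [set: T])) _
  (fun x => (x.2, x.1)))//; split=> //=.
  by move=> [x1 x2] [y1 y2] _ _ /= [-> ->].
by move=> [x y] _; exists (y, x).
Qed.

Lemma ge_esum T (a : T -> \bar R) i : (forall j, 0 <= a j) ->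
  a i <= \esum_(j in setT) a j.
Proof.
move=> a0; apply: esum_ge; exists [set i]; last by rewrite fsbig_set1.
by split=> //; exact: finite_set1.
Qed.

(** An inequality rather than an equality, so that [c] may be infinite; it is applied to factors
    that are themselves unordered sums. *)
Lemma esum_scale_le T (c : \bar R) (a : T -> \bar R) : (forall i, 0 <= a i) ->
  0 <= c -> \esum_(i in setT) (c * a i) <= c * \esum_(i in setT) a i.
Proof.
move=> a0 c0; apply: ge_ereal_sup => _ [X [finX _] <-].
rewrite -ge0_mule_fsumr// lee_wpmul2l//.
by apply: ereal_sup_ubound; exists X.
Qed.

Lemma esum_scale T (c : R) (a : T -> \bar R) : (forall i, 0 <= a i) ->
  (0 <= c)%R -> \esum_(i in setT) (c%:E * a i) = c%:E * \esum_(i in setT) a i.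
Proof.
move=> a0; rewrite le_eqVlt => /predU1P[<-|c0].
  by rewrite mul0e esum1// => i _; rewrite mul0e.
apply/eqP; rewrite eq_le esum_scale_le ?lee_fin ?(ltW c0)//=.
have cK x : x = c^-1%:E * (c%:E * x).
  by rewrite muleA -EFinM mulVf ?gt_eqF// mul1e.
have /= := @esum_scale_le T c^-1%:E (fun i => c%:E * a i).
under eq_esum do rewrite -cK.
have ca0 i : 0 <= c%:E * a i by rewrite mule_ge0 ?lee_fin ?(ltW c0).
move=> /(_ ca0); rewrite lee_fin invr_ge0 (ltW c0) => /(_ isT).
have cE0 : 0 <= c%:E by rewrite lee_fin (ltW c0).
move=> /(lee_wpmul2l cE0).
by rewrite muleA -EFinM mulfV ?gt_eqF// mul1e.
Qed.

Lemma esum_tail T (a : T -> \bar R) (e : R) : (forall i, 0 <= a i) ->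
  \esum_(i in setT) a i < +oo -> (0 < e)%R ->
  exists2 F, finite_set F & \esum_(i in ~` F) a i <= e%:E.
Proof.
move=> a0 fin e0.
have afin : \esum_(i in setT) a i \is a fin_num.
  by rewrite ge0_fin_numE// esum_ge0.
have [_ [F [finF _] <-]] := ub_ereal_sup_adherent e0 afin.
rewrite -/(\esum_(i in setT) a i) => H; exists F => //.
have := esumID F setT a (fun i _ => a0 i); rewrite !setTI (esum_fset finF)// => E.
have sfin : \sum_(i \in F) a i \is a fin_num.
  rewrite ge0_fin_numE ?fsume_ge0//; apply: le_lt_trans fin.
  by rewrite E leeDl// esum_ge0.
move: H; rewrite E lteBlDr// lteD2lE// => /ltW //.
Qed.

Lemma esum_geometric_lty (C r : R) : (0 <= C)%R -> (0 <= r < 1)%R ->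
  \esum_(n in [set: nat]) (C * r ^+ n)%:E < +oo.
Proof.
move=> C0 /andP[r0 r1]; rewrite -nneseries_esumT; last first.
  by move=> n; rewrite lee_fin mulr_ge0// exprn_ge0.
apply: (@le_lt_trans _ _ (C / (1 - r))%:E); last exact: ltry.
apply: lime_le.
  by apply: is_cvg_nneseries => n _ _; rewrite lee_fin mulr_ge0// exprn_ge0.
apply: nearW => n; rewrite sumEFin lee_fin.
have -> : (\sum_(0 <= i < n) C * r ^+ i)%R = series (geometric C r) n by [].
have d0 : (0 < 1 - r)%R by rewrite subr_gt0.
rewrite geometric_seriesE ?lt_eqF// ler_pM2r ?invr_gt0//.
by rewrite ler_piMr// gerBl exprn_ge0.
Qed.

Lemma poweR_le (p : R) (x y : \bar R) : (0 <= p)%R -> 0 <= x -> x <= y ->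
  x `^ p <= y `^ p.
Proof.
move=> p0 x0 xy; apply: gt0_ler_poweR => //.
  by rewrite in_itv /= x0 leey.
by rewrite in_itv /= (le_trans x0 xy) leey.
Qed.

(* With S the sum of the x_i^p, each x_i is at most S^(1/p-1) x_i^p. *)
Lemma poweR_esum_le T (p : R) (x : T -> \bar R) : (0 < p <= 1)%R ->
  (forall i, 0 <= x i) ->
  (\esum_(i in setT) x i) `^ p <= \esum_(i in setT) x i `^ p.
Proof.
move=> /andP[p0 p1] x0; set S := leRHS.
have S0 : 0 <= S by apply: esum_ge0 => i _; exact: poweR_ge0.
have pN0 : p != 0%R by rewrite gt_eqF.
have pV0 : (0 <= p^-1 - 1)%R by rewrite subr_ge0 invr_ge1 ?unitfE ?gt_eqF.
have split y : 0 <= y -> y `^ p^-1 = y * y `^ (p^-1 - 1).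
  move=> y0; rewrite -[X in X * _]poweRe1// -poweRD ?(addrC 1%R) ?subrK//.
  by apply: add_neq0_poweRD_def; rewrite addrC subrK invr_neq0.
have xp i : x i = x i `^ p * (x i `^ p) `^ (p^-1 - 1).
  by rewrite -split ?poweR_ge0// -poweRrM mulfV// poweRe1.
have -> : S = (S `^ p^-1) `^ p by rewrite -poweRrM mulVf// poweRe1.
apply: poweR_le; [exact: ltW|exact: esum_ge0|].
rewrite split// muleC.
apply: le_trans (esum_scale_le (fun i => poweR_ge0 (x i) p) (poweR_ge0 S _)).
apply: le_esum => i _; rewrite [leLHS]xp muleC lee_wpmul2r ?poweR_ge0//.
apply: poweR_le => //; first exact: poweR_ge0.
by apply: (ge_esum (a := fun i => x i `^ p)) => j; exact: poweR_ge0.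
Qed.

Lemma poweRD_le (p : R) (x y : \bar R) : (0 < p <= 1)%R -> 0 <= x -> 0 <= y ->
  (x + y) `^ p <= x `^ p + y `^ p.
Proof.
move=> p01 x0 y0.
(* The two-term inequality is the case of a sum indexed by [bool]. *)
have E (u v : \bar R) : 0 <= u -> 0 <= v ->
    \esum_(b in [set: bool]) (if b then u else v) = u + v.
  move=> u0 v0; rewrite (_ : setT = [set true; false]); last first.
    by apply/seteqP; split=> [[]|]//= _; [left|right].
  rewrite esum_fset; [|exact: finite_set2|by case].
  rewrite fsbigU ?fsbig_set1//=; do ?exact: finite_set1.
  by move=> b /= [-> //].
rewrite -E// -(E (x `^ p)) ?poweR_ge0//.
apply: (le_trans (poweR_esum_le p01 _)); first by case.
by apply: le_esum => -[].
Qed.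

End UnorderedSums.

(** * Sums of [p]-th powers and scalar convolution on [Z2] *)

Section MajorantConvolution.
Context {R : realType}.
Local Open Scope ereal_scope.
Implicit Types (a b : Z2 -> R) (x y : Z2 -> \bar R) (p : R).

(** The [p]-th power of the [l^p] quasi-norm. No root is taken, since for [p <= 1] this power is
    subadditive and submultiplicative under convolution. *)
Definition psum p x := \esum_(n in [set: Z2]) x n `^ p.

(** Convolution seen as an operator on sequences that may take the value [+oo], so that it can be
    iterated without convergence conditions. *)
Definition econv a x : Z2 -> \bar R :=
  fun n => \esum_(m in [set: Z2]) (a m)%:E * x (n - m)%R.

Definition in_box L (k : Z2) := (absz k.1 <= L)%N && (absz k.2 <= L)%N.

Lemma psum_ge0 p x : 0 <= psum p x.
Proof. by apply: esum_ge0 => n _; exact: poweR_ge0. Qed.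

Lemma psum1 x : (forall n, 0 <= x n) -> psum 1 x = \esum_(n in setT) x n.
Proof. by move=> x0; apply: eq_esum => n _; rewrite poweRe1. Qed.

Lemma le_psum p x y : (0 <= p)%R -> (forall n, 0 <= x n) ->
  (forall n, x n <= y n) -> psum p x <= psum p y.
Proof. by move=> p0 x0 xy; apply: le_esum => n _; exact: poweR_le. Qed.

Lemma psumD p x y : (0 < p <= 1)%R -> (forall n, 0 <= x n) ->
  (forall n, 0 <= y n) -> psum p (x \+ y) <= psum p x + psum p y.
Proof.
move=> p01 x0 y0; rewrite -esumD; do ?by move=> *; exact: poweR_ge0.
by apply: le_esum => n _; exact: poweRD_le.
Qed.

Lemma econv_ge0 a x n : (forall m, 0 <= a m)%R -> (forall m, 0 <= x m) ->
  0 <= econv a x n.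
Proof. by move=> a0 x0; apply: esum_ge0 => m _; rewrite mule_ge0 ?lee_fin. Qed.

Lemma le_econv a x y n : (forall m, 0 <= a m)%R -> (forall m, x m <= y m) ->
  econv a x n <= econv a y n.
Proof. by move=> a0 xy; apply: le_esum => m _; rewrite lee_wpmul2l ?lee_fin. Qed.

Lemma esum_shift x m : \esum_(n in [set: Z2]) x (n - m)%R = \esum_(n in setT) x n.
Proof.
rewrite [RHS](@reindex_esum _ _ _ [set: Z2] _ (fun n : Z2 => n - m)%R)//.
split=> //=; first by move=> u v _ _ /addIr.
by move=> n _; exists (n + m)%R => //; rewrite addrK.
Qed.

(** Subadditivity of the [p]-th power over the inner sum, then exchange of the two sums and
    translation invariance. *)
Lemma psum_econv p a x : (0 < p <= 1)%R -> (forall m, 0 <= a m)%R ->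
  (forall m, 0 <= x m) ->
  psum p (econv a x) <= psum p (EFin \o a) * psum p x.
Proof.
move=> p01 a0 x0.
have t0 (m n : Z2) : 0 <= (a m)%:E `^ p * x (n - m)%R `^ p.
  by rewrite mule_ge0 ?poweR_ge0.
apply: (@le_trans _ _ (\esum_(n in [set: Z2]) \esum_(m in [set: Z2])
    ((a m)%:E `^ p * x (n - m)%R `^ p))).
  apply: le_esum => n _; apply: le_trans (poweR_esum_le p01 _) _.
    by move=> m; rewrite mule_ge0 ?lee_fin.
  by apply: le_esum => m _; rewrite poweRM ?lee_fin.
rewrite esum_swap; last by move=> n m; exact: t0.
apply: (@le_trans _ _ (\esum_(m in [set: Z2]) (psum p x * (a m)%:E `^ p))).
  apply: le_esum => m _; rewrite muleC.
  apply: le_trans (esum_scale_le _ (poweR_ge0 _ _)) _ => [n|].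
    exact: poweR_ge0.
  by rewrite (esum_shift (fun n => x n `^ p)).
by rewrite muleC esum_scale_le ?psum_ge0// => m; exact: poweR_ge0.
Qed.

Lemma econvD a x y n : (forall m, 0 <= a m)%R -> (forall m, 0 <= x m) ->
  (forall m, 0 <= y m) -> econv a (x \+ y) n = econv a x n + econv a y n.
Proof.
move=> a0 x0 y0; rewrite -esumD; do ?by move=> *; rewrite mule_ge0 ?lee_fin.
by apply: eq_esum => m _; rewrite ge0_muleDr.
Qed.

Lemma econvDl a b x n : (forall m, 0 <= a m)%R -> (forall m, 0 <= b m)%R ->
  (forall m, 0 <= x m) ->
  econv (a \+ b)%R x n = econv a x n + econv b x n.
Proof.
move=> a0 b0 x0; rewrite -esumD; do ?by move=> *; rewrite mule_ge0 ?lee_fin.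
by apply: eq_esum => m _; rewrite EFinD ge0_muleDl ?lee_fin.
Qed.

Lemma econvC a b x : (forall m, 0 <= a m)%R -> (forall m, 0 <= b m)%R ->
  (forall m, 0 <= x m) -> econv a (econv b x) = econv b (econv a x).
Proof.
move=> a0 b0 x0; apply/funext => n.
have E c d : (forall m, 0 <= c m)%R -> (forall m, 0 <= d m)%R ->
    econv c (econv d x) n = \esum_(m in [set: Z2]) \esum_(k in [set: Z2])
      ((c m * d k)%:E * x (n - m - k)%R).
  move=> c0 d0; apply: eq_esum => m _; rewrite -esum_scale//.
    by apply: eq_esum => k _; rewrite muleA.
  by move=> k; rewrite mule_ge0 ?lee_fin.
rewrite !E// esum_swap; last by move=> m k; rewrite mule_ge0// lee_fin mulr_ge0.
by apply: eq_esum => m _; apply: eq_esum => k _; rewrite mulrC addrAC.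
Qed.

Lemma econv_in_box a x L M : (forall m, ~~ in_box L m -> a m = 0%R) ->
  (forall m, ~~ in_box M m -> x m = 0) ->
  forall n, ~~ in_box (L + M) n -> econv a x n = 0.
Proof.
move=> aL xM n nLM; apply: esum1 => m _.
have [mL|mL] := boolP (in_box L m); last by rewrite aL// mul0e.
rewrite xM ?mule0//; apply: contra nLM => /andP[n1 n2].
by move: mL => /andP[m1 m2]; move: n1 n2; rewrite /in_box /=; lia.
Qed.

(** The box has [(2 * L + 1) ^ 2] points. This converts a uniform bound on [p]-th powers into a
    bound on their sum, at the cost of the volume. *)
Lemma esum_in_box_le x L (v : \bar R) : (forall m, 0 <= x m <= v) ->
  (forall m, ~~ in_box L m -> x m = 0) ->
  \esum_(n in [set: Z2]) x n <= ((2 * L + 1) ^ 2)%:R%:E * v.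
Proof.
move=> xv xL; have v0 : 0 <= v by case/andP: (xv 0%R) => /le_trans; exact.
pose s := [seq (i%:Z - L%:Z, j%:Z - L%:Z)%R | i <- iota 0 (2 * L + 1), j <- iota 0 (2 * L + 1)].
have sL (k : Z2) : in_box L k -> k \in s.
  case: k => k1 k2 /andP[/= h1 h2]; apply/allpairsP.
  exists (absz (k1 + L%:Z)%R, absz (k2 + L%:Z)%R); rewrite !mem_iota /=; split; try lia.
  by congr pair; lia.
suff H (r : seq Z2) : uniq r ->
    \sum_(i <- r) x i <= ((2 * L + 1) ^ 2)%:R%:E * v.
  apply: ge_ereal_sup => _ [X [finX _] <-].
  by rewrite fsbig_finite//; apply: H; exact: finmap.fset_uniq.
move=> ur; apply: (@le_trans _ _ (\sum_(i <- r | i \in s) x i)).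
  rewrite (bigID (fun i => i \in s)) /= [X in _ + X]big1 ?adde0// => i si.
  by apply: xL; apply: contra si; exact: sL.
rewrite -big_filter; set t := [seq i <- r | i \in s].
have sz : (size t <= (2 * L + 1) ^ 2)%N.
  rewrite (@leq_trans (size s))//.
    apply: uniq_leq_size; first by rewrite filter_uniq.
    by move=> i; rewrite mem_filter => /andP[].
  by rewrite size_allpairs size_iota expnS expn1.
apply: (@le_trans _ _ ((size t)%:R%:E * v)); last first.
  by rewrite lee_wpmul2r// lee_fin ler_nat.
elim: (t) => [|i u IH]; first by rewrite big_nil mul0e.
rewrite big_cons /= -natr1 EFinD ge0_muleDl ?lee_fin ?ler0n// mul1e addeC leeD//.
by case/andP: (xv i).
Qed.

Lemma exists_box (X : set Z2) : finite_set X -> exists L, X `<=` in_box L.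
Proof.
move=> finX.
exists (\sum_(k <- finmap.enum_fset (fset_set X)) (absz k.1 + absz k.2))%N => k Xk.
have kX : k \in finmap.enum_fset (fset_set X) by rewrite in_fset_set// inE.
rewrite /in_box; move: (finmap.enum_fset _) kX => r; elim: r => // i r IH.
rewrite inE big_cons => /predU1P[->|/IH /andP[h1 h2]].
  by rewrite -addnA leq_addr addnCA leq_addr.
by rewrite !(leq_trans _ (leq_addl _ _)).
Qed.

(** By Bernoulli's inequality, the side of a box that is affine in [i] is absorbed by a geometric
    growth of ratio as close to 1 as desired. *)
Lemma affine_le_geometric (x : R) M L i : (0 < x)%R ->
  ((2 * (M * i + L) + 1)%:R <=
    ((2 * M)%:R / x + (2 * L + 1)%:R) * (1 + x) ^+ i)%R.
Proof.
move=> x0.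
have Bern : (1 + i%:R * x <= (1 + x) ^+ i)%R.
  elim: i => [|j IH]; first by rewrite mul0r addr0 expr0.
  rewrite exprS -natr1; have : (0 <= j%:R :> R)%R by rewrite ler0n.
  by move: IH; nra.
have q0 : (0 <= (2 * M)%:R / x)%R by rewrite divr_ge0 ?ler0n// ltW.
have L1 : (1 <= (2 * L + 1)%:R :> R)%R by rewrite ler1n addn1.
have ix0 : (0 <= i%:R * x)%R by rewrite mulr_ge0 ?ler0n// ltW.
apply: le_trans (ler_wpM2l _ Bern); last by lra.
have -> : (2 * (M * i + L) + 1 = (2 * M) * i + (2 * L + 1))%N by lia.
rewrite natrD natrM.
have -> : ((2 * M)%:R * i%:R = (2 * M)%:R / x * (i%:R * x) :> R)%R.
  by field; rewrite gt_eqF.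
by move: q0 L1 ix0; nra.
Qed.

(* Write H = a + b with a supported in a box and sum b^p small.  The p-sum of
   a^i grows like (sum a)^(ip) up to the volume of the box, and powers of a and
   b commute, so H^n decays geometrically although the p-sum of H may be large. *)
Lemma neumann_majorant_lty p (H : Z2 -> R) (X0 : Z2 -> \bar R) L :
  (0 < p <= 1)%R -> (forall m, 0 <= H m)%R ->
  psum 1 (EFin \o H) < 1 -> psum p (EFin \o H) < +oo ->
  (forall n, 0 <= X0 n) -> (forall n, ~~ in_box L n -> X0 n = 0) ->
  psum 1 X0 < +oo ->
  psum p (fun n => \esum_(i in [set: nat]) iter i (econv H) X0 n) < +oo.
Proof.
move=> p01 H0 H1 Hp X00 XL X01; have /andP[p0 p1] := p01.
have pN0 : p != 0%R by rewrite gt_eqF.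
pose eta := fine (psum 1 (EFin \o H)).
have etaE : psum 1 (EFin \o H) = eta%:E.
  by rewrite fineK// ge0_fin_numE ?psum_ge0// (lt_trans H1)// ltry.
have eta0 : (0 <= eta)%R by rewrite -lee_fin -etaE psum_ge0.
have eta1 : (eta < 1)%R by rewrite -lte_fin -etaE.
pose t := (eta `^ p)%R.
have t0 : (0 <= t)%R by exact: powR_ge0.
have t1 : (t < 1)%R.
  have := @gt0_ltr_powR R p p0 eta 1%R; rewrite !nnegrE powR1; exact.
(* Powers of the box part [a] will decay with ratio [th], strictly between [t] and 1, and the
   remainder [b] has [p]-sum at most [be]; the sum [th + be] is still less than 1. *)
pose th := ((t + 1) / 2)%R; pose be := ((1 - t) / 4)%R.
have be0 : (0 < be)%R by rewrite /be; lra.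
(* [x] leaves room for the volume of the boxes: a factor [(1 + x) ^+ 2] per step keeps the ratio
   within [th]. *)
pose x := ((1 - t) / 6)%R.
have x0 : (0 < x)%R by rewrite /x; lra.
have xth : ((1 + x) ^+ 2 * t <= th)%R by rewrite /x /th; nra.
have [F finF HF] := esum_tail (fun n => poweR_ge0 (H n)%:E p) Hp be0.
have [M FM] := exists_box finF.
pose a n := if in_box M n then H n else 0%R.
pose b n := if in_box M n then 0%R else H n.
have a0 n : (0 <= a n)%R by rewrite /a; case: ifP.
have b0 n : (0 <= b n)%R by rewrite /b; case: ifP.
have Hab : H = (a \+ b)%R.
  by apply/funext => n; rewrite /a /b /=; case: ifP; rewrite ?addr0 ?add0r.
have bb : psum p (EFin \o b) <= be%:E.
  apply: le_trans HF; rewrite [leRHS]esum_mkcond; apply: le_esum => n _ /=.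
  rewrite in_setC /b; case: ifPn => nM; rewrite ?powR0//.
    by case: ifP; rewrite // lee_fin powR_ge0.
  by rewrite ifT//; apply/negP; rewrite inE => /FM; apply/negP.
have a1 : psum 1 (EFin \o a) <= eta%:E.
  rewrite -etaE; by apply: le_psum => // n; rewrite /= lee_fin// /a; case: ifP.
pose k := fine (psum 1 X0).
have kE : psum 1 X0 = k%:E by rewrite fineK// ge0_fin_numE ?psum_ge0.
have k0 : (0 <= k)%R by rewrite -lee_fin -kE psum_ge0.
have it0 (c : Z2 -> R) i X : (forall m, 0 <= c m)%R -> (forall n, 0 <= X n) ->
    forall n, 0 <= iter i (econv c) X n.
  by move=> c0 X0'; elim: i => // i IH n; exact: econv_ge0.
have aX1 i : psum 1 (iter i (econv a) X0) <= (eta ^+ i * k)%:E.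
  elim: i => [|i IH]; first by rewrite expr0 mul1r kE.
  apply: le_trans (psum_econv _ a0 (it0 _ _ _ a0 X00)) _; first lra.
  rewrite exprS -mulrA EFinM; apply: lee_pmul => //; exact: psum_ge0.
have aXs i n : ~~ in_box (M * i + L) n -> iter i (econv a) X0 n = 0.
  elim: i n => [|i IH] n; first by rewrite muln0; exact: XL.
  rewrite mulnS -addnA; apply: econv_in_box => //.
  by move=> m mM; rewrite /a (negbTE mM).
pose C := (((2 * M)%:R / x + (2 * L + 1)%:R) ^+ 2 * k `^ p)%R.
have C0 : (0 <= C)%R by rewrite mulr_ge0 ?powR_ge0// sqr_ge0.
have th0 : (0 <= th)%R by rewrite /th; lra.
(* Each value is at most the total sum [eta ^+ i * k], and the support lies in a box of radius
   [M * i + L]. The [p]-sum is thus [t ^+ i] times a volume quadratic in [i], which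
   [(1 + x) ^+ (2 * i)] absorbs. *)
have aXp i : psum p (iter i (econv a) X0) <= (C * th ^+ i)%:E.
  have := @esum_in_box_le (fun n => iter i (econv a) X0 n `^ p) (M * i + L)
    ((eta ^+ i * k)%:E `^ p).
  move=> /(_ _ _)/le_trans; apply.
  - move=> n; apply/andP; split; first exact: poweR_ge0.
    apply: poweR_le; [exact: ltW|exact: it0|].
    apply: le_trans (aX1 i); rewrite psum1; last exact: it0.
    by apply: (ge_esum (a := iter i (econv a) X0)); exact: it0.
  - by move=> n nb; rewrite aXs// poweR0r.
  rewrite poweR_EFin -EFinM lee_fin powRM ?exprn_ge0//.
  have -> : ((eta ^+ i) `^ p = t ^+ i)%R.
    by rewrite /t -[(eta ^+ i)%R]powR_mulrn// powRAC powR_mulrn// powR_ge0.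
  apply: (@le_trans _ _ (C * ((1 + x) ^+ 2 * t) ^+ i)%R); last first.
    by rewrite ler_wpM2l// lerXn2r ?nnegrE// mulr_ge0 ?sqr_ge0.
  pose D : R := ((2 * M)%:R / x + (2 * L + 1)%:R)%R.
  have -> : (C * ((1 + x) ^+ 2 * t) ^+ i = D ^+ 2 * ((1 + x) ^+ 2) ^+ i * (t ^+ i * k `^ p))%R.
    rewrite /C -/D exprMn.
    move: (D ^+ 2)%R (k `^ p)%R (((1 + x) ^+ 2) ^+ i)%R (t ^+ i)%R => u1 u2 u3 u4.
    by ring.
  rewrite ler_wpM2r ?mulr_ge0 ?exprn_ge0 ?powR_ge0//.
  rewrite exprAC -exprMn natrX lerXn2r ?nnegrE ?ler0n//.
    by rewrite mulr_ge0 ?exprn_ge0 ?addr_ge0 ?divr_ge0 ?ler0n//; lra.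
  exact: affine_le_geometric.
(* Induction on the number of factors [H], for all numbers of factors [a] at once: the [a] part of
   one [H] raises [i], its [b] part costs a factor [be]. This replaces the binomial expansion. *)
have main n i : psum p (iter i (econv a) (iter n (econv H) X0)) <=
    (C * th ^+ i * (th + be) ^+ n)%:E.
  elim: n i => [|n IH] i; first by rewrite expr0 mulr1.
  have z0 := it0 H n X0 H0 X00.
  set z := iter n (econv H) X0 in IH z0 *.
  (* The innermost [H] is split, and commutativity moves its [b] outside the [i] factors [a]. *)
  have -> : iter i (econv a) (econv H z) =
      iter i.+1 (econv a) z \+ econv b (iter i (econv a) z).
    elim: (i) => [|j IHj]; first by apply/funext => m; rewrite -[in RHS]econvDl// -Hab.
    rewrite iterS IHj; apply/funext => m; rewrite econvD//=; last 2 first.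
    - by apply: (it0 a j.+1).
    - by move=> m'; apply: econv_ge0 => //; exact: it0.
    by rewrite [econv a (econv b _)]econvC//; exact: it0.
  apply: (le_trans (psumD p01 _ _)).
  - exact: it0.
  - by move=> m; apply: econv_ge0 => //; exact: it0.
  rewrite exprS mulrDl mulrDr EFinD leeD//.
    have -> : (C * th ^+ i * (th * (th + be) ^+ n) = C * th ^+ i.+1 * (th + be) ^+ n)%R.
      by rewrite exprS; ring.
    exact: IH.
  apply: (le_trans (psum_econv p01 b0 (it0 a i z a0 z0))).
  have -> : (C * th ^+ i * (be * (th + be) ^+ n) = be * (C * th ^+ i * (th + be) ^+ n))%R.
    by ring.
  rewrite EFinM; apply: lee_pmul => //; exact: psum_ge0.
apply: (@le_lt_trans _ _ (\esum_(n in [set: Z2]) \esum_(i in [set: nat])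
    (iter i (econv H) X0 n) `^ p)).
  by apply: le_esum => n _; apply: poweR_esum_le => // i; exact: it0.
rewrite esum_swap; last by move=> *; exact: poweR_ge0.
apply: (@le_lt_trans _ _ (\esum_(i in [set: nat]) (C * (th + be) ^+ i)%:E)).
  by apply: le_esum => i _; have := main i 0%N; rewrite expr0 mulr1.
apply: esum_geometric_lty => //; apply/andP; split; rewrite /th /be; lra.
Qed.

End MajorantConvolution.

(** * Unordered sums in a Banach algebra *)

(** The order of [R[i]] only compares numbers with equal imaginary parts, so the radii given by the
    topology of [A] are real. *)
Lemma gt0_complexP (R : realType) (c : R[i]) : 0 < c ->
  exists2 e : R, 0 < e & c = e%:C.
Proof.
move=> c0; exists (complex.Re c); last by rewrite RRe_real// gtr0_real.
by rewrite -(ltcR 0) RRe_real// gtr0_real.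
Qed.

Section RealNorm.
Context {R : realType} {A : banachAlgType R[i]}.
Implicit Types (a b : A).

Lemma rnormE a : `|a| = (rnorm a)%:C.
Proof. by rewrite /rnorm RRe_real ?normr_real. Qed.

Lemma rnorm_ge0 a : 0 <= rnorm a.
Proof. by rewrite -ler0c -rnormE normr_ge0. Qed.

Lemma rnormD a b : rnorm (a + b) <= rnorm a + rnorm b.
Proof. by have := ler_normD a b; rewrite !rnormE -rmorphD lecR. Qed.

Lemma rnormM a b : rnorm (a * b) <= rnorm a * rnorm b.
Proof. by have := @banach_normM _ A a b; rewrite !rnormE -rmorphM lecR. Qed.

Lemma rnormZ (c : R[i]) a : rnorm (c *: a) = cabs c * rnorm a.
Proof. by have := normrZ c a; rewrite !rnormE cabsE -rmorphM => /complexI. Qed.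

Lemma rnormN a : rnorm (- a) = rnorm a.
Proof. by rewrite /rnorm normrN. Qed.

Lemma rnormB a b : rnorm (a - b) <= rnorm a + rnorm b.
Proof. by rewrite -(rnormN b) rnormD. Qed.

Lemma rnorm0 : rnorm (0 : A) = 0.
Proof. by rewrite /rnorm normr0. Qed.

Lemma rnorm_eq0 a : rnorm a = 0 -> a = 0.
Proof. by move=> a0; apply/eqP; rewrite -normr_eq0 rnormE a0. Qed.

Lemma rnorm_le_eq0 a : (forall e : R, 0 < e -> rnorm a <= e) -> a = 0.
Proof.
move=> H; apply: rnorm_eq0; apply/eqP; rewrite eq_le rnorm_ge0 andbT.
by apply/ler_addgt0Pr => e e0; rewrite add0r; exact: H.
Qed.

End RealNorm.

#[local] Existing Instance summability.totally_filter.

Section VectorSums.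
Context {R : realType} {A : banachAlgType R[i]} {T : choiceType}.
Implicit Types (u v : T -> A) (F G : {fset T}).
Local Notation sum := summability.sum.
Local Notation totally := (@summability.totally T).

Definition enorm u : T -> \bar R := fun i => (rnorm (u i))%:E.

Definition abs_summable u := (\esum_(i in [set: T]) enorm u i < +oo)%E.

Lemma enorm_ge0 u i : (0 <= enorm u i)%E.
Proof. by rewrite lee_fin rnorm_ge0. Qed.

Let tail u F : \bar R := \esum_(i in ~` [set` F]) enorm u i.

Let partial u F : A := \sum_(i <- F) u i.

Lemma sum_unique u (s : A) :
  (forall e : R, 0 < e -> exists F, forall G, (F `<=` G)%fset ->
    rnorm (s - partial u G) <= e) -> sum u = s.
Proof.
move=> H; apply: cvg_lim => //; apply/cvgrPdist_le => _ /gt0_complexP[e e0 ->].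
have [F HF] := H e e0; exists F => //= G FG; rewrite rnormE lecR.
by rewrite /summability.partial_sum -(big_seq_fsetE _ _ xpredT u); exact: HF.
Qed.

Let tail_ge u F G : (F `<=` G)%fset ->
  ((rnorm (partial u G - partial u F))%:E <= tail u F)%E.
Proof.
move=> FG; have -> : partial u G - partial u F = partial u (G `\` F)%fset.
  rewrite /partial (big_fsetID _ (mem F)) /=.
  have -> : [fset x in G | x \in F]%fset = F.
    by apply/fsetP => x; rewrite !inE /=; case xF: (x \in F); rewrite ?andbF// (fsubsetP FG).
  rewrite [X in X - _]addrC addrK; apply: eq_fbigl => x; rewrite !inE /=; exact: andbC.
apply: esum_ge; exists [set` (G `\` F)%fset].
  split; first exact: finite_fset.
  by move=> x /=; rewrite inE => /andP[/negP].
rewrite fsbig_finite ?finite_fset//= set_fsetK /enorm sumEFin lee_fin /partial.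
elim/big_ind2 : _ => [|x y z t xy zt|//]; first by rewrite rnorm0.
by rewrite (le_trans (rnormD _ _))// lerD.
Qed.

Let small_tail u (e : R) : abs_summable u -> 0 < e ->
  exists F, (tail u F <= e%:E)%E.
Proof.
move=> us e0; have [F finF HF] := esum_tail (enorm_ge0 u) us e0.
by exists (fset_set F); rewrite /tail fset_setK.
Qed.

(** Completeness of [A] enters here: partial sums over sets containing a suitable finite [F] differ
    from the one over [F] by at most a small tail, so the net is Cauchy. *)
Lemma sum_cvg u : abs_summable u ->
  summability.partial_sum u @ totally --> sum u.
Proof.
move=> us; apply: cauchy_cvg; apply: cauchy_exP => _ /gt0_complexP[e e0 ->].
have e20 : 0 < e / 2 by rewrite divr_gt0.
have [F HF] := small_tail us e20.
exists (partial u F), F => //= G FG.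
rewrite -ball_normE /= distrC rnormE ltcR.
rewrite /summability.partial_sum -(big_seq_fsetE _ _ xpredT u).
have : rnorm (partial u G - partial u F) <= e / 2.
  by rewrite -lee_fin; apply: le_trans HF; exact: tail_ge.
by move: e20; rewrite /partial; lra.
Qed.

Lemma sum_approx u (e : R) : abs_summable u -> 0 < e ->
  exists F, forall G, (F `<=` G)%fset -> rnorm (sum u - \sum_(i <- G) u i) <= e.
Proof.
move=> us e0; have eC : 0 < e%:C by rewrite (ltcR 0).
have /cvgrPdist_le/(_ _ eC)[F _ HF] := sum_cvg us.
exists F => G FG; rewrite -lecR -rnormE.
by have := HF G FG; rewrite /summability.partial_sum -(big_seq_fsetE _ _ xpredT u).
Qed.

Lemma sum_tail u F : abs_summable u ->
  ((rnorm (sum u - \sum_(i <- F) u i))%:E <= \esum_(i in ~` [set` F]) enorm u i)%E.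
Proof.
move=> us; apply/lee_addgt0Pr => e e0.
have [G HG] := sum_approx us e0.
have := HG _ (fsubsetUr F G); have := tail_ge u (fsubsetUl F G).
set P := partial u (F `|` G)%fset => H1 H2.
apply: (@le_trans _ _ ((rnorm (P - partial u F))%:E + e%:E)%E); last by rewrite leeD.
rewrite -EFinD lee_fin (_ : sum u - _ = (P - partial u F) + (sum u - P)).
  by rewrite (le_trans (rnormD _ _))// lerD.
by rewrite [RHS]addrC addrA subrK.
Qed.

Lemma rnorm_sum_le u : ((rnorm (sum u))%:E <= \esum_(i in [set: T]) enorm u i)%E.
Proof.
have [us|] := boolP (\esum_(i in [set: T]) enorm u i < +oo)%E; last first.
  by rewrite -leNgt leye_eq => /eqP ->; rewrite leey.
have := sum_tail fset0 us; rewrite big_seq_fset0 subr0.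
by rewrite (_ : ~` _ = setT)//; apply/seteqP; split=> x //=; rewrite inE.
Qed.

Lemma abs_summableD u v : abs_summable u -> abs_summable v ->
  abs_summable (fun i => u i + v i).
Proof.
move=> us vs; apply: (@le_lt_trans _ _ (\esum_(i in [set: T]) (enorm u i + enorm v i))%E).
  by apply: le_esum => i _; rewrite -EFinD lee_fin rnormD.
by rewrite esumD ?lte_add_pinfty// => i _; exact: enorm_ge0.
Qed.

Lemma sumD u v : abs_summable u -> abs_summable v ->
  sum (fun i => u i + v i) = sum u + sum v.
Proof.
move=> us vs; apply: sum_unique => e e0; have e20 : 0 < e / 2 by rewrite divr_gt0.
have [F HF] := sum_approx us e20; have [F' HF'] := sum_approx vs e20.
exists (F `|` F')%fset => G; rewrite fsubUset => /andP[FG F'G].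
rewrite /partial big_split /= opprD addrACA (le_trans (rnormD _ _))//.
by rewrite [e]splitr lerD ?HF ?HF'.
Qed.

Lemma sum_linear u (phi : A -> A) (C : R) :
  (forall a b, phi (a + b) = phi a + phi b) ->
  (forall a, rnorm (phi a) <= C * rnorm a) -> abs_summable u ->
  sum (fun i => phi (u i)) = phi (sum u).
Proof.
move=> phiD phiC us.
have phi0 : phi 0 = 0 by apply: (addrI (phi 0)); rewrite -phiD !addr0.
have phiN a : phi (- a) = - phi a.
  by apply/eqP; rewrite -addr_eq0 -phiD addNr phi0.
(* No sign is assumed on [C], hence this positive divisor. *)
have C0 : 0 < `|C| + 1 by rewrite ltr_wpDl.
apply: sum_unique => e e0; have d0 : 0 < e / (`|C| + 1) by rewrite divr_gt0.
have [F HF] := sum_approx us d0; exists F => G /HF H.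
have -> : partial (fun i => phi (u i)) G = phi (\sum_(i <- G) u i).
  rewrite /partial; elim/big_ind2 : _ => [|x y z t -> ->|//]; first by rewrite phi0.
  by rewrite phiD.
rewrite -phiN -phiD (le_trans (phiC _))//.
move: H; rewrite ler_pdivlMr// => H; have := rnorm_ge0 (sum u - \sum_(i <- G) u i).
have := ler_norm C; nra.
Qed.

Lemma sum_single u i0 : (forall i, i != i0 -> u i = 0) -> sum u = u i0.
Proof.
move=> u0; apply: sum_unique => e e0; exists [fset i0]%fset => G.
rewrite fsub1set => iG; rewrite /partial (big_fsetD1 i0)//= big1_fset ?addr0 ?subrr ?rnorm0 ?ltW//.
by move=> i; rewrite !inE => /andP[ii0 _] _; exact: u0.
Qed.

Lemma sum_reindex u (h h' : T -> T) : cancel h h' -> cancel h' h ->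
  abs_summable u -> sum (fun i => u (h i)) = sum u.
Proof.
move=> hK h'K us; apply: sum_unique => e e0.
have [F HF] := sum_approx us e0; exists (h' @` F)%fset => G FG.
have -> : partial (fun i => u (h i)) G = \sum_(i <- (h @` G)%fset) u i.
  by rewrite big_imfset//= => x y _ _; exact: (can_inj hK).
apply: HF; apply/fsubsetP => x xF; rewrite -(h'K x) in_imfset//=.
by apply: (fsubsetP FG); rewrite in_imfset.
Qed.

End VectorSums.

(** * Convolution *)

Section Convolution.
Context {R : realType} {A : banachAlgType R[i]}.
Implicit Types (f g h : Z2 -> A) (p : R).
Local Notation sum := summability.sum.
Local Notation L1 := (@abs_summable R A Z2).

Definition l1norm f : R := fine (\esum_(n in [set: Z2]) enorm f n).

Definition single (m : Z2) (a : A) : Z2 -> A := fun n => if n == m then a else 0.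

Lemma l1normE f : L1 f -> (\esum_(n in [set: Z2]) enorm f n)%E = (l1norm f)%:E.
Proof. by move=> f1; rewrite fineK// ge0_fin_numE// esum_ge0// => n _; exact: enorm_ge0. Qed.

Lemma psum1_enorm f : psum 1 (enorm f) = (\esum_(n in [set: Z2]) enorm f n)%E.
Proof. by apply: psum1; exact: enorm_ge0. Qed.

Lemma l1norm_ge0 f : 0 <= l1norm f.
Proof. by rewrite fine_ge0// esum_ge0// => n _; exact: enorm_ge0. Qed.

Lemma rnorm_le_l1norm f n : L1 f -> rnorm (f n) <= l1norm f.
Proof.
by move=> f1; rewrite -lee_fin -l1normE//; apply: (ge_esum (a := enorm f)) => m; exact: enorm_ge0.
Qed.

Let rconv f g n := fun m => f (n - m) * g m.

(** The right factor becomes the kernel of [econv], so that the powers of [h], built by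
    multiplication on the right, are dominated by iterates of one scalar operator. *)
Lemma esum_enorm_conv f g n :
  (\esum_(m in [set: Z2]) enorm (rconv f g n) m <= econv (rnorm \o g) (enorm f) n)%E.
Proof.
by apply: le_esum => m _; rewrite -EFinM lee_fin mulrC rnormM.
Qed.

Lemma enorm_convol f g n :
  (enorm (convol f g) n <= econv (rnorm \o g) (enorm f) n)%E.
Proof. exact: le_trans (rnorm_sum_le _) (esum_enorm_conv _ _ _). Qed.

Lemma psum_convol p f g : 0 < p <= 1 ->
  (psum p (enorm (convol f g)) <= psum p (enorm g) * psum p (enorm f))%E.
Proof.
move=> p01; apply: le_trans (psum_econv p01 _ _).
- apply: le_psum; [by case/andP: p01 => /ltW| |]; first exact: enorm_ge0.
  exact: enorm_convol.
- by move=> m; exact: rnorm_ge0.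
- exact: enorm_ge0.
Qed.

Let conv_esum_le f g : L1 f -> L1 g ->
  (\esum_(n in [set: Z2]) econv (rnorm \o g) (enorm f) n <= (l1norm f * l1norm g)%:E)%E.
Proof.
move=> f1 g1; have p01 : 0 < (1 : R) <= 1 by rewrite ltr01 lexx.
have := @psum_econv R 1 (rnorm \o g) (enorm f) p01 (fun m => rnorm_ge0 _) (enorm_ge0 f).
rewrite [psum 1 (EFin \o _)]psum1_enorm psum1_enorm !l1normE// -EFinM mulrC psum1//.
by move=> n; apply: econv_ge0; [move=> m; exact: rnorm_ge0|exact: enorm_ge0].
Qed.

Lemma rconv_summable f g n : L1 f -> L1 g -> L1 (fun m => f (n - m) * g m).
Proof.
move=> f1 g1; apply: (le_lt_trans (esum_enorm_conv _ _ _)).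
apply: (le_lt_trans _ (ltry (l1norm f * l1norm g))).
apply: le_trans (conv_esum_le f1 g1).
apply: (ge_esum (a := econv (rnorm \o g) (enorm f))) => m.
by apply: econv_ge0; [move=> k; exact: rnorm_ge0|exact: enorm_ge0].
Qed.

Lemma convol_esum_le f g : L1 f -> L1 g ->
  (\esum_(n in [set: Z2]) enorm (convol f g) n <= (l1norm f * l1norm g)%:E)%E.
Proof.
move=> f1 g1; apply: le_trans (conv_esum_le f1 g1).
by apply: le_esum => n _; exact: enorm_convol.
Qed.

Lemma convol_summable f g : L1 f -> L1 g -> L1 (convol f g).
Proof. by move=> f1 g1; exact: le_lt_trans (convol_esum_le f1 g1) (ltry _). Qed.

Lemma l1norm_convol f g : L1 f -> L1 g ->
  l1norm (convol f g) <= l1norm f * l1norm g.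
Proof.
move=> f1 g1; rewrite -lee_fin -l1normE ?convol_esum_le//.
exact: convol_summable.
Qed.

Lemma l1normD f g : L1 f -> L1 g -> l1norm (f + g) <= l1norm f + l1norm g.
Proof.
move=> f1 g1; rewrite -lee_fin EFinD -!l1normE//; last exact: abs_summableD.
rewrite -esumD; do ?by move=> *; exact: enorm_ge0.
by apply: le_esum => n _; rewrite -EFinD lee_fin rnormD.
Qed.

Lemma abs_summableZ (c : R[i]) f : L1 f -> L1 (c *: f).
Proof.
move=> f1; apply: (@le_lt_trans _ _ ((cabs c)%:E * (l1norm f)%:E)%E); last exact: ltry.
rewrite -l1normE// -esum_scale ?cabs_ge0//; last exact: enorm_ge0.
by apply: le_esum => n _; rewrite /enorm rnormZ EFinM.
Qed.

Lemma l1normZ (c : R[i]) f : L1 f -> l1norm (c *: f) = cabs c * l1norm f.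
Proof.
move=> f1; apply: EFin_inj; rewrite -l1normE; last exact: abs_summableZ.
rewrite EFinM -l1normE// -esum_scale ?cabs_ge0//; last exact: enorm_ge0.
by apply: eq_esum => n _; rewrite /enorm rnormZ EFinM.
Qed.

Lemma abs_summable_single m a : L1 (single m a).
Proof.
rewrite /abs_summable (@le_lt_trans _ _ (\esum_(n in [set m]) enorm (single m a) n)%E)//.
  rewrite [leRHS]esum_mkcond; apply: le_esum => n _.
  rewrite /enorm /single; case: ifPn => [/eqP ->|nm]; first by rewrite in_set1 eqxx.
  by rewrite in_set1 (negbTE nm) rnorm0.
by rewrite esum_set1 ?ltry ?enorm_ge0.
Qed.

Lemma abs_summable0 : L1 (0 : Z2 -> A).
Proof.
by rewrite /abs_summable esum1 ?ltry// => n _; rewrite /enorm rnorm0.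
Qed.

(** The remainder of [f] after removal of a finite truncation. *)
Definition off f (s : seq Z2) : Z2 -> A := fun n => if n \in s then 0 else f n.

Lemma off_summable f s : L1 f -> L1 (off f s).
Proof.
move=> f1; apply: le_lt_trans f1; apply: le_esum => n _; rewrite lee_fin /off.
by case: ifP => // _; rewrite rnorm0 rnorm_ge0.
Qed.

Lemma off_cons f m s : off f s = single m (off f s m) + off f (m :: s).
Proof.
apply/funext => n; rewrite addrfctE /off /single inE.
by case: (eqVneq n m) => [->|] /=; rewrite ?addr0 ?add0r.
Qed.

Lemma l1norm_off f (e : R) : L1 f -> 0 < e -> exists s, l1norm (off f s) <= e.
Proof.
move=> f1 e0; have [F finF HF] := esum_tail (enorm_ge0 f) f1 e0.
exists (enum_fset (fset_set F)); rewrite -lee_fin -l1normE; last exact: off_summable.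
apply: le_trans HF; rewrite [leRHS]esum_mkcond; apply: le_esum => n _.
rewrite in_setC /off /enorm in_fset_set//.
by case: (n \in F) => //=; rewrite rnorm0.
Qed.

(** Density of finitely supported functions: removing points one at a time leaves [D f] unchanged,
    and what remains has arbitrarily small norm. *)
Lemma vanish_on_summable (D : (Z2 -> A) -> A) (C : R) :
  (forall f g, L1 f -> L1 g -> D (f + g) = D f + D g) ->
  (forall f, L1 f -> rnorm (D f) <= C * l1norm f) ->
  (forall m a, D (single m a) = 0) -> forall f, L1 f -> D f = 0.
Proof.
move=> DD DC D0 f f1; apply: rnorm_le_eq0 => e e0.
have C0 : 0 < `|C| + 1 by rewrite ltr_wpDl.
have d0 : 0 < e / (`|C| + 1) by rewrite divr_gt0.
have [s Hs] := l1norm_off f1 d0.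
have <- : D (off f s) = D f.
  elim: s {Hs} => [|m s <-] //; rewrite [in RHS](off_cons f m).
  by rewrite DD ?D0 ?add0r//; [exact: abs_summable_single|exact: off_summable].
rewrite (le_trans (DC _ (off_summable s f1)))//.
move: Hs; rewrite ler_pdivlMr//; have := l1norm_ge0 (off f s); have := ler_norm C.
nra.
Qed.

Lemma convolDl f g h : L1 f -> L1 g -> L1 h ->
  convol (f + g) h = convol f h + convol g h.
Proof.
move=> f1 g1 h1; apply/funext => n; rewrite [in RHS]addrfctE /convol -sumD ?rconv_summable//.
by congr sum; apply/funext => m; rewrite -mulrDl.
Qed.

Lemma convolDr f g h : L1 f -> L1 g -> L1 h ->
  convol f (g + h) = convol f g + convol f h.
Proof.
move=> f1 g1 h1; apply/funext => n; rewrite [in RHS]addrfctE /convol -sumD ?rconv_summable//.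
by congr sum; apply/funext => m; rewrite -mulrDr.
Qed.

Lemma convol_single_l m a f n : L1 f -> convol (single m a) f n = a * f (n - m).
Proof.
move=> f1; rewrite /convol (@sum_single _ _ _ _ (n - m)).
  by rewrite /single opprB addrC subrK eqxx.
move=> k km; rewrite /single ifN ?mul0r//; apply: contra km => /eqP <-.
by rewrite opprB addrC subrK.
Qed.

Lemma convol_single_r m a f n : L1 f -> convol f (single m a) n = f (n - m) * a.
Proof.
move=> f1; rewrite /convol (@sum_single _ _ _ _ m).
  by rewrite /single eqxx.
by move=> k km; rewrite /single ifN ?mulr0.
Qed.

(** Both sides are additive and bounded in [f], so by density [f] may be a point mass; the identity
    then says that left multiplication by [a] passes through a sum. *)
Lemma convolA f g h : L1 f -> L1 g -> L1 h ->
  convol f (convol g h) = convol (convol f g) h.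
Proof.
move=> f1 g1 h1; apply/funext => n; apply/eqP; rewrite -subr_eq0; apply/eqP.
pose D f' := convol f' (convol g h) n - convol (convol f' g) h n.
apply: (@vanish_on_summable D (2 * (l1norm g * l1norm h))) => //.
- move=> u v u1 v1; rewrite /D !convolDl ?convol_summable//.
  by rewrite !addrfctE opprD addrACA.
- move=> u u1; rewrite /D (le_trans (rnormB _ _))//.
  have gh := l1norm_convol g1 h1; have ug := l1norm_convol u1 g1.
  have H1 := l1norm_convol u1 (convol_summable g1 h1).
  have H2 := l1norm_convol (convol_summable u1 g1) h1.
  have K1 := rnorm_le_l1norm n (convol_summable u1 (convol_summable g1 h1)).
  have K2 := rnorm_le_l1norm n (convol_summable (convol_summable u1 g1) h1).
  have := l1norm_ge0 u; have := l1norm_ge0 h; nra.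
- move=> m a; rewrite /D convol_single_l ?convol_summable//.
  rewrite (_ : convol (convol (single m a) g) h n = a * convol g h (n - m)) ?subrr//.
  rewrite /convol -(@sum_linear _ _ _ _ (fun x => a * x) (rnorm a)).
  - congr sum; apply/funext => k; rewrite -/(convol (single m a) g (n - k)).
    by rewrite convol_single_l// mulrA addrAC.
  - by move=> x y; rewrite mulrDr.
  - by move=> x; exact: rnormM.
  - exact: rconv_summable.
Qed.

End Convolution.

(** * The convolution algebra [ell1 A] of absolutely summable functions *)

Section ConvolutionAlgebra.
Context {R : realType} {A : banachAlgType R[i]}.

Definition summable_pred : {pred (Z2 -> A)} := fun f => `[< abs_summable f >].

(** A subtype carrying convolution as its ring product, so that the elimination of unitary central
    elements applies to it as an [algType]. *)
Record ell1 := Ell1 { ell1_val :> Z2 -> A; _ : ell1_val \in summable_pred }.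

HB.instance Definition _ := [isSub for ell1_val].
HB.instance Definition _ := [Choice of ell1 by <:].

Lemma summable_submod_closed : submod_closed summable_pred.
Proof.
split; first by apply/asboolP; exact: abs_summable0.
move=> c f g /asboolP f1 /asboolP g1; apply/asboolP.
by apply: abs_summableD => //; exact: abs_summableZ.
Qed.

HB.instance Definition _ := GRing.isSubmodClosed.Build _ _ summable_pred
  summable_submod_closed.
HB.instance Definition _ := [SubChoice_isSubLmodule of ell1 by <:].

Lemma ell1P (f : ell1) : abs_summable f.
Proof. by case: f => f /= /asboolP. Qed.

Definition to_ell1 f (f1 : abs_summable f) : ell1 := Ell1 (asboolT f1).

Lemma ell1_eq (f g : ell1) : (f : Z2 -> A) = g -> f = g.
Proof. exact: val_inj. Qed.

Lemma ell1D (f g : ell1) : (f + g : ell1) = (f : Z2 -> A) + (g : Z2 -> A) :> (Z2 -> A).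
Proof. by []. Qed.

Definition ell1_mul (f g : ell1) : ell1 :=
  to_ell1 (convol_summable (ell1P f) (ell1P g)).

Definition ell1_one : ell1 := to_ell1 (abs_summable_single 0 1).

Lemma ell1_mulA : associative ell1_mul.
Proof. by move=> f g h; apply: ell1_eq; apply: convolA; exact: ell1P. Qed.

Lemma ell1_mul1 : left_id ell1_one ell1_mul.
Proof.
move=> f; apply: ell1_eq; apply/funext => n /=.
by rewrite convol_single_l ?mul1r ?subr0//; exact: ell1P.
Qed.

Lemma ell1_mulr1 : right_id ell1_one ell1_mul.
Proof.
move=> f; apply: ell1_eq; apply/funext => n /=.
by rewrite convol_single_r ?mulr1 ?subr0//; exact: ell1P.
Qed.

Lemma ell1_mulDl : left_distributive ell1_mul +%R.
Proof. by move=> f g h; apply: ell1_eq; apply: convolDl; exact: ell1P. Qed.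

Lemma ell1_mulDr : right_distributive ell1_mul +%R.
Proof. by move=> f g h; apply: ell1_eq; apply: convolDr; exact: ell1P. Qed.

Lemma ell1_one_neq0 : ell1_one != 0.
Proof.
apply/eqP => /(congr1 (fun f : ell1 => (f : Z2 -> A) 0)) /=.
by rewrite /single eqxx => /eqP; rewrite oner_eq0.
Qed.

HB.instance Definition _ := GRing.Zmodule_isNzRing.Build ell1
  ell1_mulA ell1_mul1 ell1_mulr1 ell1_mulDl ell1_mulDr ell1_one_neq0.

Lemma ell1_scaleAl (c : R[i]) (f g : ell1) : c *: (f * g) = (c *: f) * g.
Proof.
apply: ell1_eq; apply/funext => n.
rewrite -[LHS]/(c *: convol f g n) -[RHS]/(convol (c *: (f : Z2 -> A)) g n).
rewrite /convol -(@sum_linear _ _ _ _ (fun x => c *: x) (cabs c)).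
- by congr summability.sum; apply/funext => m; rewrite scalerAl.
- by move=> x y; rewrite scalerDr.
- by move=> x; rewrite rnormZ.
- by apply: rconv_summable; exact: ell1P.
Qed.

HB.instance Definition _ := GRing.Lmodule_isLalgebra.Build R[i] ell1 ell1_scaleAl.

Lemma ell1_scaleAr (c : R[i]) (f g : ell1) : c *: (f * g) = f * (c *: g).
Proof.
apply: ell1_eq; apply/funext => n.
rewrite -[LHS]/(c *: convol f g n) -[RHS]/(convol f (c *: (g : Z2 -> A)) n).
rewrite /convol -(@sum_linear _ _ _ _ (fun x => c *: x) (cabs c)).
- by congr summability.sum; apply/funext => m; rewrite scalerAr.
- by move=> x y; rewrite scalerDr.
- by move=> x; rewrite rnormZ.
- by apply: rconv_summable; exact: ell1P.
Qed.

HB.instance Definition _ := GRing.Lalgebra_isAlgebra.Build R[i] ell1 ell1_scaleAr.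

End ConvolutionAlgebra.
Arguments ell1 {R} A.

(** * Neumann series in [ell1 A] *)

Section Neumann.
Context {R : realType} {A : banachAlgType R[i]}.
Implicit Types f g h : ell1 A.

Lemma ell1_normD f g : l1norm (f + g) <= l1norm f + l1norm g.
Proof. by apply: l1normD; exact: ell1P. Qed.

Lemma ell1_normZ (c : R[i]) f : l1norm (c *: f) = cabs c * l1norm f.
Proof. by apply: l1normZ; exact: ell1P. Qed.

Lemma ell1_normM f g : l1norm (f * g) <= l1norm f * l1norm g.
Proof. by apply: l1norm_convol; exact: ell1P. Qed.

Lemma l1norm_eq0 f : l1norm f = 0 -> f = 0.
Proof.
move=> f0; apply: ell1_eq; apply/funext => n; apply: rnorm_eq0.
by apply/eqP; rewrite eq_le rnorm_ge0 andbT -f0 rnorm_le_l1norm//; exact: ell1P.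
Qed.

Lemma ell1_val_sum (F : seq nat) (x : nat -> ell1 A) n :
  (\sum_(i <- F) x i : ell1 A) n = \sum_(i <- F) (x i n).
Proof.
by elim: F => [|i F IH]; rewrite ?big_nil// !big_cons -IH.
Qed.

Let expn_esum h i : l1norm h < 1 ->
  (\esum_(n in [set: Z2]) enorm (h ^+ i : ell1 A)%R n <= (l1norm (1 : ell1 A)%R * l1norm h ^+ i)%:E)%E.
Proof.
move=> h1; rewrite l1normE ?lee_fin; last exact: ell1P.
elim: i => [|i IH]; first by rewrite !expr0 mulr1.
rewrite exprSr (le_trans (ell1_normM _ _))// [in leRHS]exprSr mulrA.
by rewrite ler_wpM2r// l1norm_ge0.
Qed.

Let geo h : l1norm h < 1 -> (\esum_(i in [set: nat]) \esum_(n in [set: Z2])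
  enorm (h ^+ i : ell1 A)%R n < +oo)%E.
Proof.
move=> h1; apply: le_lt_trans (le_esum (fun i _ => expn_esum i h1)) _.
by apply: esum_geometric_lty; rewrite ?l1norm_ge0.
Qed.

(** The series of powers is summed in [A] at each point of [Z2]. The pointwise bound is kept for the
    case [p < 1], where the scalar majorant controls the [p]-sum. *)
Lemma ell1_neumann h : l1norm h < 1 -> exists2 u : ell1 A, u * (1 - h) = 1 &
  forall n, (enorm u n <= \esum_(i in [set: nat]) enorm (h ^+ i : ell1 A)%R n)%E.
Proof.
move=> h1.
have s n : abs_summable (fun i => (h ^+ i : ell1 A)%R n).
  apply: le_lt_trans (geo h1); apply: le_esum => i _.
  by apply: (ge_esum (a := enorm (h ^+ i : ell1 A)%R)) => m; exact: enorm_ge0.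
pose v : Z2 -> A := fun n => summability.sum (fun i => (h ^+ i : ell1 A)%R n).
have vn n : (enorm v n <= \esum_(i in [set: nat]) enorm (h ^+ i : ell1 A)%R n)%E by exact: rnorm_sum_le.
have v1 : abs_summable v.
  apply: (le_lt_trans _ (geo h1)).
  rewrite esum_swap; last by move=> *; exact: enorm_ge0.
  by apply: le_esum => n _; exact: vn.
pose u := to_ell1 v1; exists u => //.
apply/eqP; rewrite -subr_eq0; apply/eqP/l1norm_eq0/eqP; rewrite eq_le l1norm_ge0 andbT.
pose B := l1norm (1 - h).
apply/ler_addgt0Pr => e e0; rewrite add0r.
have B0 : 0 <= B by exact: l1norm_ge0.
(* With [S] the sum of the first [k] powers, the defect of [u] is [(u - S) * (1 - h) - h ^+ k]; each
   of the two terms is allowed [e / 2]. *)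
have d0 : 0 < e / (2 * (B + 1)) by rewrite divr_gt0 ?mulr_gt0//; lra.
have [F finF HF] := esum_tail (fun i => esum_ge0 (fun n _ => enorm_ge0 (h ^+ i : ell1 A)%R n)) (geo h1) d0.
have [k0 Hk0] : exists k, l1norm (1 : ell1 A) * l1norm h ^+ k <= e / 2.
  have K0 := l1norm_ge0 (1 : ell1 A).
  have /cvgrPdist_le /(_ (e / (2 * (l1norm (1 : ell1 A) + 1)))) :
      (fun n => l1norm h ^+ n) @ \oo --> (0 : R).
    by apply: cvg_expr; rewrite ger0_norm ?l1norm_ge0.
  case; first by rewrite divr_gt0 ?mulr_gt0//; lra.
  move=> k _ /(_ k (leqnn k)) /=.
  rewrite sub0r normrN ger0_norm ?exprn_ge0 ?l1norm_ge0// => Hk; exists k.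
  move: Hk; rewrite ler_pdivlMr ?mulr_gt0//; last lra.
  have : 0 <= l1norm h ^+ k by rewrite exprn_ge0 ?l1norm_ge0.
  nra.
(* [k] is at least [k0], which makes [h ^+ k] small, and exceeds every index in [F], so the powers
   missing from [S] all lie in the small tail. *)
pose k := (k0 + \sum_(i <- fset_set F) i.+1)%N.
have Fk i : F i -> (i < k)%N.
  move=> Fi; have : i \in enum_fset (fset_set F) by rewrite in_fset_set// inE.
  rewrite /k; elim: (enum_fset _) => // j r IH; rewrite inE big_cons => /predU1P[->|/IH]; lia.
have Hk : l1norm (1 : ell1 A) * l1norm h ^+ k <= e / 2.
  apply: le_trans Hk0; rewrite ler_wpM2l ?l1norm_ge0// ler_wiXn2l ?l1norm_ge0 ?(ltW h1)//.
  by rewrite leq_addr.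
pose S := \sum_(i <- iota 0 k) h ^+ i.
have Sh : S * (1 - h) = 1 - h ^+ k.
  rewrite /S; elim: (k) => [|j IH]; first by rewrite big_nil mul0r expr0 subrr.
  by rewrite -addn1 iotaD big_cat big_seq1 mulrDl IH /= add0n mulrBr mulr1 addn1 -exprSr addrA subrK.
have uS : l1norm (u - S) <= e / (2 * (B + 1)).
  rewrite -lee_fin -l1normE; last exact: ell1P.
  apply: le_trans HF; rewrite [leRHS]esum_mkcond.
  rewrite (eq_esum (b := fun i => \esum_(n in [set: Z2])
    (if i \in ~` F then enorm (h ^+ i : ell1 A)%R n else 0%E))); last first.
    by move=> i _; case: ifP => // _; rewrite esum1.
  rewrite esum_swap; last by move=> i n; case: ifP => // _; exact: enorm_ge0.
  apply: le_esum => n _; have := sum_tail [fset i in iota 0 k]%fset (s n).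
  rewrite /enorm -/(v n) => H.
  have -> : (u - S : ell1 A) n = v n - \sum_(i <- [fset i in iota 0 k]%fset) (h ^+ i : ell1 A)%R n.
    rewrite (@perm_big _ _ _ _ _ (iota 0 k)) /=.
      by rewrite -(ell1_val_sum (iota 0 k) (fun i => h ^+ i)).
    by apply: uniq_perm; rewrite ?fset_uniq ?iota_uniq// => i; rewrite !inE.
  apply: (le_trans H); rewrite esum_mkcond; apply: le_esum => i _.
  rewrite !in_setC; case: ifPn => [ik|_]; last by case: ifP => // _; rewrite lee_fin rnorm_ge0.
  rewrite ifT//; apply: contra ik; rewrite !inE => /Fk ik /=; rewrite !inE mem_iota.
  exact: ik.
have -> : u * (1 - h) - 1 = (u - S) * (1 - h) - h ^+ k.
  by rewrite mulrBl Sh opprB -addrA [h ^+ k - 1 - _]addrAC subrr sub0r.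
apply: (le_trans (ell1_normD _ _)); rewrite [e]splitr lerD//.
  apply: (le_trans (ell1_normM _ _)); rewrite -/B.
  move: uS; rewrite ler_pdivlMr ?mulr_gt0//; last lra.
  have := l1norm_ge0 (u - S : ell1 A); nra.
rewrite -scaleN1r ell1_normZ cabsN cabs1 mul1r.
by apply: le_trans Hk; rewrite -lee_fin -l1normE ?expn_esum//; exact: ell1P.
Qed.

End Neumann.

(** * Wiener's lemma *)

Lemma Z2_subgroup_full (P : Z2 -> Prop) : P 0 ->
  (forall m n, P m -> P n -> P (m + n)) -> (forall m, P m -> P (- m)) ->
  P (1, 0) -> P (0, 1) -> forall n, P n.
Proof.
move=> P0 PD PN P1 P2.
have PMn m k : P m -> P (m *+ k).
  by move=> Pm; elim: k => [|k IH]; rewrite ?mulr0n// mulrS; exact: PD.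
have PMz m (k : int) : P m -> P (m *~ k).
  by case: k => k Pm; [exact: PMn|rewrite NegzE mulrNz; apply: PN; exact: PMn].
move=> [a b]; have -> : (a, b) = ((1, 0) : Z2) *~ a + ((0, 1) : Z2) *~ b.
  have E1 (k : nat) : ((1, 0) : Z2) *+ k = (k%:Z, 0).
    by elim: k => // k IH; rewrite mulrS IH; congr pair; lia.
  have E2 (k : nat) : ((0, 1) : Z2) *+ k = (0, k%:Z).
    by elim: k => // k IH; rewrite mulrS IH; congr pair; lia.
  have F1 (k : int) : ((1, 0) : Z2) *~ k = (k, 0).
    by case: k => k; rewrite ?NegzE ?mulrNz ?[_ *~ _]E1.
  have F2 (k : int) : ((0, 1) : Z2) *~ k = (0, k).
    by case: k => k; rewrite ?NegzE ?mulrNz ?[_ *~ _]E2.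
  by rewrite F1 F2; congr pair; rewrite /= ?addr0 ?add0r.
by apply: PD; exact: PMz.
Qed.

Section Wiener.
Context {R : realType} {A : banachAlgType R[i]}.
Implicit Types (f g x y : ell1 A).

(** Convolution with [delta_ m] is translation by [m]. These are the central, isometric, invertible
    elements to be eliminated. *)
Definition delta_ (m : Z2) : ell1 A := to_ell1 (abs_summable_single m 1).
Definition const_ (a : A) : ell1 A := to_ell1 (abs_summable_single 0 a).

Lemma delta_mulE x m n : (delta_ m * x) n = x (n - m).
Proof. by rewrite -[LHS]/(convol _ _ n) convol_single_l ?mul1r//; exact: ell1P. Qed.

Lemma delta_C x m : delta_ m * x = x * delta_ m.
Proof.
apply: ell1_eq; apply/funext => n; rewrite delta_mulE.
by rewrite -[RHS]/(convol _ _ n) convol_single_r ?mulr1//; exact: ell1P.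
Qed.

Lemma delta_D m n : delta_ m * delta_ n = delta_ (m + n).
Proof.
apply: ell1_eq; apply/funext => k; rewrite delta_mulE /= /single.
by rewrite subr_eq addrC.
Qed.

Lemma delta_0 : delta_ 0 = 1.
Proof. by []. Qed.

Lemma l1norm_delta_mul x m : l1norm (delta_ m * x) = l1norm x.
Proof.
rewrite /l1norm -[in RHS](esum_shift _ m); congr fine; apply: eq_esum => n _.
by rewrite /enorm delta_mulE.
Qed.

Lemma const_M a b : const_ (a * b) = const_ a * const_ b.
Proof.
apply: ell1_eq; apply/funext => n.
rewrite -[RHS]/(convol (single 0 a) _ n) convol_single_l; last exact: ell1P.
by rewrite subr0 /= /single; case: ifP; rewrite ?mulr0.
Qed.

Lemma const_D a b : const_ (a + b) = const_ a + const_ b.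
Proof.
apply: ell1_eq; apply/funext => n; rewrite ell1D addrfctE /= /single.
by case: ifP; rewrite ?addr0.
Qed.

Lemma const_Z (c : R[i]) a : const_ (c *: a) = c *: const_ a.
Proof.
apply: ell1_eq; apply/funext => n.
by rewrite -[RHS]/(c *: single 0 a n) /= /single; case: ifP; rewrite ?scaler0.
Qed.

Lemma single_const m a (sm : ell1 A) : (sm : Z2 -> A) = single m a -> sm = const_ a * delta_ m.
Proof.
move=> E; apply: ell1_eq; apply/funext => n; rewrite E.
rewrite -[RHS]/(convol (single 0 a) _ n) convol_single_l; last exact: ell1P.
by rewrite subr0 /= /single; case: ifP; rewrite ?mulr1 ?mulr0.
Qed.

Lemma l1norm_const a : l1norm (const_ a) = rnorm a.
Proof.
apply: EFin_inj; rewrite -l1normE; last exact: ell1P.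
rewrite (esumID [set 0]) ?setTI; last by move=> n _; exact: enorm_ge0.
rewrite esum_set1 ?enorm_ge0// esum1 ?adde0 /enorm /= /single ?eqxx//.
by move=> n /eqP/negPf n0; rewrite n0 rnorm0.
Qed.

Definition ell1_off x s : ell1 A := to_ell1 (off_summable s (ell1P x)).

Section Evaluation.
Context (z : R[i] * R[i]).
Hypothesis zT : torus2 z.

Let chi (n : Z2) : R[i] := z.1 ^ n.1 * z.2 ^ n.2.

Let z1 : z.1 != 0.
Proof. by case: zT => h _; rewrite -normr_eq0 h oner_eq0. Qed.

Let z2 : z.2 != 0.
Proof. by case: zT => _ h; rewrite -normr_eq0 h oner_eq0. Qed.

Let chiD m n : chi (m + n) = chi m * chi n.
Proof. by rewrite /chi !expfzDr//=; ring. Qed.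

Let chiN n : chi (- n) * chi n = 1.
Proof. by rewrite -chiD addNr /chi /= !expr0z mulr1. Qed.

Let cabs_chi n : cabs (chi n) = 1.
Proof.
have N1 (c : R[i]) (k : int) : `|c| = 1 -> `|c ^ k| = 1.
  by case: k => k c1; rewrite ?NegzE -?exprnP -?exprnN ?normfV normrX c1 expr1n ?invr1.
by case: zT => h1 h2; apply: (@complexI R); rewrite -cabsE /chi normrM !N1 ?mulr1.
Qed.

Let chi_summable (f : Z2 -> A) : abs_summable f -> abs_summable (fun n => chi n *: f n).
Proof.
move=> f1; apply: le_lt_trans f1; apply: le_esum => n _.
by rewrite /enorm rnormZ cabs_chi mul1r.
Qed.

Lemma rnorm_hat (f : Z2 -> A) : abs_summable f -> rnorm (hat f z) <= l1norm f.
Proof.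
move=> f1; rewrite -lee_fin -l1normE// (le_trans (rnorm_sum_le _))//.
by apply: le_esum => n _; rewrite /enorm rnormZ cabs_chi mul1r.
Qed.

Lemma hatD (f g : Z2 -> A) : abs_summable f -> abs_summable g ->
  hat (f + g) z = hat f z + hat g z.
Proof.
move=> f1 g1; rewrite /hat -(sumD (chi_summable f1) (chi_summable g1)).
by congr summability.sum; apply/funext => n; rewrite -scalerDr.
Qed.

Lemma hat_single m (a : A) : hat (single m a) z = chi m *: a.
Proof.
rewrite /hat (@sum_single _ _ _ _ m); first by rewrite /single eqxx.
by move=> i im; rewrite /single (negPf im) scaler0.
Qed.

(** The left ideal imposing [delta_ (1, 0) = z.1] and [delta_ (0, 1) = z.2]. Its generators are
    written in the form [1 - w z] used by [unitary_elimination]. *)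
Let I x := exists c c', x = c * (1 - z.1^-1 *: delta_ (1, 0)) + c' * (1 - z.2^-1 *: delta_ (0, 1)).

Let ID x y : I x -> I y -> I (x + y).
Proof.
move=> [c [c' ->]] [d [d' ->]]; exists (c + d), (c' + d').
by rewrite !mulrDl addrACA.
Qed.

Let IM a x : I x -> I (a * x).
Proof. by move=> [c [c' ->]]; exists (a * c), (a * c'); rewrite mulrDr !mulrA. Qed.

Let IZ (c : R[i]) x : I x -> I (c *: x).
Proof. by move=> Ix; rewrite -[x]mul1r scalerAl; exact: IM. Qed.

Let I0 : I 0.
Proof. by exists 0, 0; rewrite !mul0r addr0. Qed.

(** Multiplicativity of [chi] makes the set of such [n] a subgroup of [Z2], and it contains both
    generators. *)
Let delta_chi n : I (delta_ n - chi n *: 1).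
Proof.
move: n; apply: Z2_subgroup_full.
- by rewrite /chi /= !expr0z mulr1 scale1r delta_0 subrr.
- move=> m n Im In; rewrite -delta_D chiD.
  have -> : delta_ m * delta_ n - (chi m * chi n) *: 1 =
    delta_ m * (delta_ n - chi n *: 1) + chi n *: (delta_ m - chi m *: 1).
    rewrite mulrBr -scalerAr mulr1 scalerBr scalerA [chi n * _]mulrC.
    by rewrite addrA subrK.
  by apply: ID; [exact: IM|exact: IZ].
- move=> m Im.
  have -> : delta_ (- m) - chi (- m) *: 1 = (- chi (- m)) *: (delta_ (- m) * (delta_ m - chi m *: 1)).
    rewrite mulrBr delta_D addNr delta_0 -scalerAr mulr1 scalerBr scalerA mulNr chiN.
    by rewrite scaleN1r opprK scaleNr addrC.
  by apply: IZ; exact: IM.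
- rewrite /chi /= expr1z expr0z mulr1.
  exists (- z.1 *: 1), 0; rewrite mul0r addr0 -scalerAl mul1r scalerBr scalerA mulNr.
  by rewrite mulfV// scaleN1r opprK scaleNr addrC.
- rewrite /chi /= expr1z expr0z mul1r.
  exists 0, (- z.2 *: 1); rewrite mul0r add0r -scalerAl mul1r scalerBr scalerA mulNr.
  by rewrite mulfV// scaleN1r opprK scaleNr addrC.
Qed.

(** Modulo [I], the finite part of [x] on [s] reduces to its value at [z]. Since [I] is only
    algebraically generated, the remainder is retained instead of passing to the limit. *)
Let off_ideal x s : exists2 i, I i &
  x = ell1_off x s + const_ (hat x z) - const_ (hat (ell1_off x s) z) + i.
Proof.
elim: s => [|m s [i Ii Ei]].
  by exists 0 => //; rewrite addr0 addrK; apply: ell1_eq.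
set a := off x s m.
exists (const_ a * (delta_ m - chi m *: 1) + i); first by apply: ID => //; exact: IM.
have E : ell1_off x s = const_ a * delta_ m + ell1_off x (m :: s).
  rewrite -(@single_const m a (to_ell1 (abs_summable_single m a)))//.
  by apply: ell1_eq; rewrite ell1D /=; exact: off_cons.
have H : hat (ell1_off x s) z = chi m *: a + hat (ell1_off x (m :: s)) z.
  rewrite -hat_single -hatD ?ell1P//; last exact: abs_summable_single.
  by congr hat; exact: off_cons.
rewrite [LHS]Ei H const_D const_Z E mulrBr -scalerAr mulr1.
set u := const_ a * _; set v := ell1_off _ _; set w := const_ (hat x z).
set t := chi m *: _; set r := const_ _.
rewrite opprD !addrA; congr (_ + i).
by rewrite -(addrA u v) (addrC u) [LHS]addrAC (addrAC _ u (- r)).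
Qed.

(** Modulo [I], [f] is [const_ (hat f z)] plus a small [r]. Multiplying by [const_ b] gives
    [1 + const_ b * r], which a Neumann series inverts. *)
Lemma hat_left_invertible_ideal f : left_invertible (hat f z) ->
  exists g c c', 1 = g * f + c * (1 - z.1^-1 *: delta_ (1, 0)) + c' * (1 - z.2^-1 *: delta_ (0, 1)).
Proof.
(* The remainder and its value at [z] both enter [r], so [const_ b * r] has norm at most
   [2 * rnorm b] times this quantity, which is below 1/2. *)
move=> [b bf]; have e0 : 0 < 1 / (4 * (rnorm b + 1)).
  by rewrite divr_gt0 ?mulr_gt0//; have := rnorm_ge0 b; lra.
have [s Hs] := l1norm_off (ell1P f) e0.
have [i Ii Ei] := off_ideal f s.
pose r := ell1_off f s - const_ (hat (ell1_off f s) z).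
have Nr : l1norm r <= 2 * l1norm (off f s).
  rewrite (le_trans (ell1_normD _ _))// -scaleN1r ell1_normZ cabsN cabs1 mul1r.
  by rewrite l1norm_const mulr_natl mulr2n lerD2l; apply: rnorm_hat; exact: ell1P.
have [|v v1 _] := @ell1_neumann _ _ (- (const_ b * r)).
  rewrite -scaleN1r ell1_normZ cabsN cabs1 mul1r (le_lt_trans (ell1_normM _ _))//.
  rewrite l1norm_const; move: Hs; rewrite ler_pdivlMr ?mulr_gt0//; last first.
    by have := rnorm_ge0 b; lra.
  have := rnorm_ge0 b; have := l1norm_ge0 r; have := l1norm_ge0 (off f s); nra.
have [c [c' E]] := IM (v * (- const_ b)) Ii.
exists (v * const_ b), c, c'; rewrite -addrA -E -[LHS]v1 opprK -!mulrA -mulrDr.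
congr (v * _); rewrite mulNr -mulrBr.
have -> : f - i = r + const_ (hat f z).
  by rewrite [in LHS]Ei addrK /r addrAC.
by rewrite [RHS]mulrDr -const_M bf addrC.
Qed.

End Evaluation.

Lemma ell1_wiener f : (forall z, torus2 z -> left_invertible (hat f z)) ->
  exists g, g * f = 1.
Proof.
move=> finv.
have dlV m : delta_ m * delta_ (- m) = 1 by rewrite delta_D subrr.
have Ndl m x : l1norm (delta_ m * x) <= l1norm x by rewrite l1norm_delta_mul.
have neumann (e : ell1 A) : l1norm e < 1 -> exists v : ell1 A, v * (1 - e) = 1.
  by move=> /ell1_neumann[v v1 _]; exists v.
pose elim m := @unitary_elimination R (ell1 A) (@l1norm R A) ell1_normD
  ell1_normZ ell1_normM neumann (delta_ m) (delta_ (- m)) (dlV m)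
  (fun x => delta_C x m) (Ndl m) (Ndl (- m)).
(* First elimination, with [J] the left ideal generated by [f]; the second one takes place in the
   larger ideal that also contains [1 - w1 *: delta_ (1, 0)]. *)
have [] := elim (1, 0) (fun x => exists g, x = g * f); last by move=> g E; exists g.
- by move=> x y [g ->] [h ->]; exists (g + h); rewrite mulrDl.
- by move=> a x [g ->]; exists (a * g); rewrite mulrA.
move=> w1 w11.
have [] := elim (0, 1) (fun x => exists g c, x = g * f + c * (1 - w1 *: delta_ (1, 0))).
- move=> x y [g [c ->]] [h [d ->]]; exists (g + h), (c + d).
  by rewrite !mulrDl addrACA.
- by move=> a x [g [c ->]]; exists (a * g), (a * c); rewrite mulrDr !mulrA.
- move=> w2 w21.
  (* The relation [1 - w *: delta_ m = 0] gives [delta_ m] the value [w^-1], hence the inverses in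
     the evaluation point. *)
  have T : torus2 (w1^-1, w2^-1).
    by split; rewrite /= normfV cabsE ?w11 ?w21 rmorph1 invr1.
  have [g [c [c' E]]] := hat_left_invertible_ideal T (finv _ T).
  exists c', g, c; rewrite !invrK in E.
  by apply/eqP; rewrite subr_eq; apply/eqP.
- by move=> g [c E]; exists c, g; apply/eqP; rewrite subr_eq; apply/eqP.
Qed.

End Wiener.

(** * Wiener's lemma for [p]-summable functions *)

Section PSummableWiener.
Context {R : realType} {A : banachAlgType R[i]} (p : R).
Hypothesis p01 : 0 < p <= 1.
Implicit Types (f g h u : ell1 A).
Local Notation psummable f := (psum p (enorm f) < +oo)%E.

Let p0 : 0 < p. Proof. by case/andP: p01. Qed.

Lemma psummable_abs (f : Z2 -> A) : psummable f -> abs_summable f.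
Proof.
move=> fp; apply: (@lty_poweRy _ _ p); first by rewrite gt_eqF.
by apply: le_lt_trans fp; apply: poweR_esum_le => // n; exact: enorm_ge0.
Qed.

Lemma psummable_convol (f g : Z2 -> A) : psummable f -> psummable g ->
  psummable (convol f g).
Proof.
move=> fp gp; apply: le_lt_trans (psum_convol f g p01) _.
by rewrite lte_mul_pinfty ?psum_ge0// ge0_fin_numE ?psum_ge0.
Qed.

Lemma psummable_finite_support f (s : seq Z2) :
  (forall n, n \notin s -> f n = 0) -> psummable f.
Proof.
move=> fs; have [L sL] := exists_box (finite_seq s).
apply: (@le_lt_trans _ _ (((2 * L + 1) ^ 2)%:R%:E * (l1norm f)%:E `^ p)%E).
  apply: esum_in_box_le => n.
    rewrite poweR_ge0 poweR_le ?enorm_ge0 ?(ltW p0)// lee_fin.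
    by apply: rnorm_le_l1norm; exact: ell1P.
  move=> nL; rewrite /enorm fs ?rnorm0 ?poweR0r ?gt_eqF//.
  by apply: contra nL; exact: sL.
by rewrite poweR_EFin -EFinM ltry.
Qed.

Let single_summable m (a : A) : psummable (single m a).
Proof.
apply: (@psummable_finite_support (to_ell1 (abs_summable_single m a)) [:: m]) => n.
by rewrite inE /= /single => /negPf ->.
Qed.

Let psummableB f g : psummable f -> psummable g -> psummable (f - g)%R.
Proof.
move=> fp gp; apply: le_lt_trans (lte_add_pinfty fp gp).
apply: le_trans (psumD p01 (enorm_ge0 f) (enorm_ge0 g)).
apply: le_psum; [exact: ltW|exact: enorm_ge0|] => n.
by rewrite -EFinD lee_fin rnormB.
Qed.

Lemma psummable_neumann h : psummable h -> l1norm h < 1 ->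
  exists2 u, u * (1 - h) = 1 & psummable u.
Proof.
move=> hp h1; have [u u1 un] := ell1_neumann h1; exists u => //.
pose H n := rnorm (h n); have H0 n : 0 <= H n by exact: rnorm_ge0.
have pow_le i n : (enorm (h ^+ i : ell1 A)%R n <= iter i (econv H) (enorm (1 : ell1 A)%R) n)%E.
  elim: i n => [|i IH] n //; rewrite exprSr iterS.
  by apply: (le_trans (enorm_convol (h ^+ i : ell1 A) h n)); exact: le_econv.
(* The iteration starts from the norms of the unit, supported at the origin: a box of radius 0. *)
apply: le_lt_trans (@neumann_majorant_lty R p H (enorm (1 : ell1 A)) 0 p01 H0 _ _ _ _ _).
- apply: le_psum; [exact: ltW|exact: enorm_ge0|] => n.
  by apply: (le_trans (un n)); apply: le_esum => i _; exact: pow_le.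
- by rewrite [psum 1 _]psum1_enorm l1normE ?lte_fin//; exact: ell1P.
- exact: hp.
- exact: enorm_ge0.
- move=> n nbox; rewrite /enorm /= /single ifN ?rnorm0//.
  by apply: contra nbox => /eqP ->.
- by rewrite psum1_enorm; exact: ell1P.
Qed.

Lemma psummable_wiener (f : Z2 -> A) : psummable f ->
  (forall z, torus2 z -> left_invertible (hat f z)) ->
  exists2 g, psummable g & convol g f = delta0.
Proof.
move=> fp finv; pose F := to_ell1 (psummable_abs fp).
have [g gF] := ell1_wiener (finv : forall z, torus2 z -> left_invertible (hat F z)).
have e0 : 0 < 1 / (2 * (l1norm F + 1)).
  by rewrite divr_gt0 ?mulr_gt0//; have := l1norm_ge0 F; lra.
have [s Hs] := l1norm_off (ell1P g) e0.
(* [g0] is a finite truncation of the [l^1] inverse. Then [h] is [p]-summable by this formula, and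
   has norm less than 1 because it also equals [ell1_off g s * F]. If [u] inverts [1 - h = g0 * F],
   then [u * g0] inverts [F]. *)
pose g0 := g - ell1_off g s; pose h := 1 - g0 * F.
have g0p : psummable g0.
  apply: (@psummable_finite_support _ s) => n ns.
  by rewrite -[LHS]/(g n - off g s n) /off (negPf ns) subrr.
have hp : psummable h.
  by apply: psummableB; [exact: single_summable|exact: psummable_convol].
have h1 : l1norm h < 1.
  have -> : h = ell1_off g s * F by rewrite /h mulrBl gF opprB addrC subrK.
  apply: le_lt_trans (ell1_normM _ _) _; move: Hs.
  rewrite ler_pdivlMr ?mulr_gt0//; last by have := l1norm_ge0 F; lra.
  have := l1norm_ge0 F; have := l1norm_ge0 (off g s); rewrite -/(l1norm (off g s)).
  rewrite [l1norm (ell1_off _ _)]/(l1norm (off g s)); nra.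
have [u u1 up] := psummable_neumann hp h1.
exists (u * g0 : ell1 A); first exact: psummable_convol.
have := congr1 (@ell1_val _ _) (etrans (esym (mulrA u g0 F)) _ : u * g0 * F = 1).
apply; rewrite -[RHS]u1; congr (u * _).
by rewrite /h opprB addrC subrK.
Qed.

End PSummableWiener.

(** * Right inverses through the opposite algebra *)

Section OppositeAlgebra.
Context {K : numFieldType} (A : banachAlgType K).

(** Kept transparent: its carrier, norm and topology must reduce to those of [A], so that [hat] and
    summability have the same meaning on both sides. *)
Definition opposite_banachAlg : banachAlgType K.
Proof.
refine (@BanachAlgebra K (banach_space A) (fun x y => banach_mul y x)
  (banach_one A) _ _ _ _ _ (banach_one_neq0 A) _ _ _).
- by move=> x y z; rewrite banach_mulA.
- exact: banach_mulr1.
- exact: banach_mul1.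
- by move=> x y z; exact: banach_mulDr.
- by move=> x y z; exact: banach_mulDl.
- by move=> k x y; exact: banach_scaleAr.
- by move=> k x y; exact: banach_scaleAl.
- by move=> x y; rewrite mulrC banach_normM.
Defined.

End OppositeAlgebra.

Section RightWiener.
Context {R : realType} {A : banachAlgType R[i]} (p : R).
Hypothesis p01 : 0 < p <= 1.
Local Notation psummable f := (psum p (enorm f) < +oo)%E.

(** The substitution of [n - m] for [m] exchanges the roles of [f] and [g], and the opposite product
    restores the order of the factors. *)
Lemma convol_opposite (f g : Z2 -> A) : abs_summable f -> abs_summable g ->
  @convol R (opposite_banachAlg A) g f = convol f g.
Proof.
move=> f1 g1; apply/funext => n; rewrite /convol.
rewrite -(@sum_reindex _ _ _ (fun m => f (n - m) * g m) (fun m => n - m) (fun m => n - m)).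
- by congr summability.sum; apply/funext => m; rewrite opprB addrCA subrr addr0.
- by move=> m; rewrite opprB addrCA subrr addr0.
- by move=> m; rewrite opprB addrCA subrr addr0.
- exact: rconv_summable.
Qed.

Lemma psummable_wiener_right (f : Z2 -> A) : psummable f ->
  (forall z, torus2 z -> right_invertible (hat f z)) ->
  exists2 g, psummable g & convol f g = delta0.
Proof.
move=> fp finv.
have [g gp gf] := @psummable_wiener R (opposite_banachAlg A) p p01 f fp finv.
exists g => //; rewrite -convol_opposite//; exact: (psummable_abs p01).
Qed.

End RightWiener.

Theorem theorem4p6 (R : realType) (A : banachAlgType R[i])
    (p : nat -> R) (w : nat -> Z2 -> R) (f : Z2 -> A) :
  typeII_data p w ->
  (forall n, property_star (w n) \/
     [\/ rho1 (w n) <> 1, rho2 (w n) <> 1, mu1 (w n) <> 1 | mu2 (w n) <> 1]) ->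
  ellp_union p w f ->
  (forall j, ellp (p j) (w j) f ->
     ~ admissible (w j) -> admissible (w j.+1) ->
     forall m n, (j < m)%N -> (m < n)%N -> p m < p n) ->
  let conclusion (inverse_of : (Z2 -> A) -> (Z2 -> A) -> Prop) :=
    exists nu : nat -> Z2 -> R,
      [/\ forall n, is_weight (nu n),
          forall n x, nu n x <= w n x,
          forall n x, nu n.+1 x <= nu n x,
          exists2 g, ellp_union p nu g & inverse_of g f &
          is_typeII (ellp_union p nu : set (Z2 -> A))] in
  [/\ (forall z, torus2 z -> left_invertible (hat f z)) ->
        conclusion is_left_inverse,
      (forall z, torus2 z -> right_invertible (hat f z)) ->
        conclusion is_right_inverse &
      (forall z, torus2 z -> invertible (hat f z)) ->
        conclusion is_inverse].
Proof.
move=> [p01 pmono wW wmono] _ [j _ fj] _ conclusion.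
(* The weight [w j] is at least 1, so dropping it only decreases the sum. *)
have fp : (psum (p j) (enorm f) < +oo)%E.
  apply: le_lt_trans fj; apply: le_esum => n _; rewrite poweR_EFin lee_fin.
  rewrite ler_peMr ?powR_ge0//; have [w1 _] := wW j.
  have /andP[pj _] := p01 j.
  have := @ge0_ler_powR R (p j) (ltW pj) 1 (w j n).
  by rewrite !nnegrE powR1; apply; rewrite ?(le_trans _ (w1 n)).
have to_conclusion (inverse_of : (Z2 -> A) -> (Z2 -> A) -> Prop) g :
    (psum (p j) (enorm g) < +oo)%E -> inverse_of g f -> conclusion inverse_of.
  move=> gp gf; exists (fun _ _ => 1); split=> //.
  - by move=> n; split=> // x y; rewrite mulr1.
  - by move=> n x; have [] := wW n.
  - exists g => //; exists j => //; rewrite /ellp /=.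
    apply: le_lt_trans gp; apply: le_esum => n _.
    by rewrite powR1 mulr1 poweR_EFin.
  - exists p, (fun _ _ => 1); split=> //; split=> //.
    by move=> n; split=> // x y; rewrite mulr1.
have left_case : (forall z, torus2 z -> left_invertible (hat f z)) ->
    exists2 g, (psum (p j) (enorm g) < +oo)%E & convol g f = delta0.
  exact: psummable_wiener.
have right_case : (forall z, torus2 z -> right_invertible (hat f z)) ->
    exists2 g, (psum (p j) (enorm g) < +oo)%E & convol f g = delta0.
  exact: psummable_wiener_right.
split=> finv.
- by have [g gp gf] := left_case finv; exact: to_conclusion gp gf.
- by have [g gp gf] := right_case finv; exact: to_conclusion gp gf.
have [|g gp gf] := left_case.
  by move=> z /finv[b [bf _]]; exists b.
have [|g' gp' fg'] := right_case.
  by move=> z /finv[b [_ fb]]; exists b.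
apply: (to_conclusion _ g gp); split=> //; rewrite /is_right_inverse.
(* The left and right inverses found separately coincide, by associativity in [ell1 A]. *)
suff -> : g = g' by [].
have L1 (h : Z2 -> A) : (psum (p j) (enorm h) < +oo)%E -> abs_summable h.
  exact: psummable_abs.
pose F := to_ell1 (L1 f fp); pose G := to_ell1 (L1 g gp); pose G' := to_ell1 (L1 g' gp').
have GF : G * F = 1 by apply: ell1_eq.
have FG : F * G' = 1 by apply: ell1_eq.
have : G = G' by rewrite -[G]mulr1 -FG mulrA GF mul1r.
by move=> /(congr1 (@ell1_val _ _)).
Qed.
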